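(* Let $\ell\in\{3,4\}$, let $q\geq 2$ be an integer, and let $\theta_\ell(q)=\sum_{n=0}^\infty q^{-n^\ell}$. If $\theta_\ell(q)$ is algebraic (over $\mathbb{Q}$), then its degree satisfies $\deg\theta_\ell(q)\geq \ell+1$.
   Context: For $\ell\in\{3,4\}$ and real $q>1$, $\theta_\ell(q)$ denotes the real number $\sum_{n=0}^\infty \frac{1}{q^{n^\ell}}$. The degree of an algebraic number is its degree over $\mathbb{Q}$. *)

(* Defs.v *)
From HB Require Import structures.
From mathcomp Require Import all_boot all_order all_algebra.
From mathcomp Require Import all_classical all_reals all_analysis.

Set Implicit Arguments.
Unset Strict Implicit.
Unset Printing Implicit Defensive.

Import Order.TTheory GRing.Theory Num.Theory.
Import numFieldNormedType.Exports.

Local Open Scope classical_set_scope.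
Local Open Scope ring_scope.

(* [limn] has an unspecified value on divergent sequences; the series converges
   for every real q > 1 (and l > 0), see [cvg_theta]. *)
Definition theta (R : realType) (l : nat) (q : R) : R :=
  limn (series (fun n : nat => (q ^+ (n ^ l)%N)^-1)).

Definition is_minpoly_rat (R : realType) (x : R) (p : {poly rat}) : Prop :=
  [/\ p \is monic, root (map_poly ratr p) x &
      forall r : {poly rat}, r != 0 -> root (map_poly ratr r) x ->
        (size p <= size r)%N].

(* Equal to 0 when x is transcendental. *)
Definition minpoly_rat (R : realType) (x : R) : {poly rat} :=
  xget 0 [set p | is_minpoly_rat x p].

(* The degree over the rationals; meaningful for algebraic x only. *)
Definition deg_rat (R : realType) (x : R) : nat := (size (minpoly_rat x)).-1.

Lemma minpoly_ratP (R : realType) (x : R) :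
  algebraicOver ratr x -> is_minpoly_rat x (minpoly_rat x).
Proof.
move=> [p0 p0_neq0 p0x].
pose P n := `[< exists p : {poly rat},
  [/\ p != 0, root (map_poly ratr p) x & size p = n] >].
have exP : exists n, P n by exists (size p0); apply/asboolP; exists p0.
case: (ex_minnP exP) => m /asboolP[p [p_neq0 px sp]] minm.
have lc_neq0 : (lead_coef p)^-1 != 0 by rewrite invr_eq0 lead_coef_eq0.
suff : is_minpoly_rat x ((lead_coef p)^-1 *: p).
  move=> h; apply: (@xgetPex _ 0 [set p | is_minpoly_rat x p]).
  by exists ((lead_coef p)^-1 *: p).
split.
- by rewrite monicE lead_coefZ mulVf// lead_coef_eq0.
- by rewrite map_polyZ /= rootZ// fmorph_eq0.
- move=> r r_neq0 rx; rewrite size_scale// sp; apply: minm.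
  by apply/asboolP; exists r.
Qed.

Lemma cvg_theta (R : realType) (l : nat) (q : R) : (0 < l)%N -> 1 < q ->
  cvgn (series (fun n : nat => (q ^+ (n ^ l)%N)^-1)).
Proof.
move=> l_gt0 q_gt1; have q_gt0 : 0 < q by apply: lt_trans q_gt1.
apply: (@series_le_cvg _ _ (geometric 1 q^-1)).
- by move=> n; rewrite invr_ge0 exprn_ge0// ltW.
- by move=> n; rewrite /= mul1r exprn_ge0// invr_ge0 ltW.
- move=> n; rewrite /= mul1r exprVn lef_pV2 ?posrE ?exprn_gt0//.
  rewrite ler_eXn2l//; case: n => // n.
  by rewrite -[leqLHS]expn1 leq_pexp2l.
- by apply: is_cvg_geometric_series; rewrite ger0_norm ?invr_ge0 ?ltW// invf_lt1.
Qed.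

(* Main.v *)
(* Suppose that sum_(j <= l) a_j theta^j = 0 with integers a_j and a_l > 0. Let
   r_j(n) be the number of representations of n as a sum of j l-th powers and
   A(n) = sum_j a_j r_j(n). Then T(N) = sum_(k >= 1) A(N + k) q^-k is an integer
   for every N. Let s < s' be consecutive sums of l - 1 l-th powers with
   g = s' - s large, and choose x^l of order g with x^l <= g / 2. Since s + x^l is
   a sum of l l-th powers and only r_l contributes to A inside the gap, T(N) > 0
   for s <= N < s + x^l (what lies beyond the gap is negligible); hence T(N) >= 1
   for a positive proportion of the N in any given arithmetic progression.

   This is contradicted by a progression along which sum_(k >= 1) r_l(N + k) q^-k
   has arbitrarily small mean. For infinitely many primes p some residue class
   mod p has at most p^(l-1) - p^(l-2) representations as a sum of l l-th powers:
   for l = 3, p = 1 mod 3 it is a class of non-cubes, for l = 4, p = 5 mod 8 it is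
   the class of 0. Both facts follow from second and fourth moments of Gauss sums,
   without Weil's bound. The sum of 1/p over these primes diverges, so that the
   Chinese remainder theorem makes all of n + 1, n + 2, ... rarely represented. *)

Require Import Defs.
From mathcomp Require Import all_boot all_order all_algebra all_field.
From mathcomp Require Import boolp.
From mathcomp Require Import zify ring lra.

Set Implicit Arguments.
Unset Strict Implicit.
Unset Printing Implicit Defensive.

Import Order.TTheory GRing.Theory Num.Theory.

(** * Gauss sums over a prime field *)

Local Open Scope ring_scope.

(** Degree l is the critical case: there are Y^l tuples of l variables below Y, as many as integers
    below Y^l, so r_l has a positive mean, and the lower bound coming from the gaps contradicts
    nothing until this mean is pushed down arithmetically. A prime p makes only one shift n + k
    rare, with relative gain 1/p, while all other shifts may get worse; hence the error at those has
    to be an arbitrarily small multiple 1/(E p) of 1/p. So the estimates modulo p must save more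
    than a factor p, and repeated gains of 1/p need exactly the divergence of the sum of 1/p. The
    modulus M may depend on the range Y, yet Y has to be a multiple of M and much larger than M;
    therefore all admissible M divide one P fixed beforehand. What lies beyond a gap is controlled
    by the relation itself: it gives T(N) = O(Y^l) for N < Y^l, so that looking D = O(log Y) steps
    ahead is enough, and the gaps of length O(D) cover only O(D Y^(l-1)) integers. *)

Lemma sum_fiber_le (I J : finType) (P : pred I) (Q : pred J) (c : nat)
    (f : I -> J) (h : J -> algC) :
  (forall i, P i -> Q (f i)) -> (forall j, Q j -> 0 <= h j) ->
  (forall j, Q j -> (#|[pred i | P i && (f i == j)]| <= c)%N) ->
  \sum_(i | P i) h (f i) <= c%:R * \sum_(j | Q j) h j.
Proof.
move=> PQ h_ge0 card_le; rewrite (partition_big f Q)//= mulr_sumr.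
apply: ler_sum => j Qj.
rewrite (eq_bigr (fun=> h j)); last by move=> i /andP[_ /eqP->].
rewrite sumr_const -[X in X <= _]mulr_natl ler_wpM2r ?h_ge0//.
by rewrite ler_nat card_le.
Qed.

Lemma card_pow_root (F : finFieldType) (l : nat) (m : F) : (0 < l)%N ->
  (#|[pred x : F | x ^+ l == m]| <= l)%N.
Proof.
move=> l_gt0; pose P : {poly F} := 'X^l - m%:P.
have sP : size P = l.+1 by rewrite size_XnsubC.
rewrite cardE -ltnS -sP; apply: max_poly_roots.
- by rewrite -size_poly_gt0 sP.
- apply/allP => x; rewrite mem_enum inE => /eqP xm.
  by rewrite rootE !hornerE xm subrr.
- exact: enum_uniq.
Qed.

Section GaussSums.
Variables (p : nat) (p_prime : prime p) (z : algC).
Hypothesis z_prim : p.-primitive_root z.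

Let F := 'F_p.
Definition addch (a : F) : algC := z ^+ (a : nat).
Local Notation e := addch.

Lemma addch_nat (n : nat) : e n%:R = z ^+ n.
Proof. by rewrite /addch val_Fp_nat// prim_expr_mod. Qed.

Lemma addchD a b : e (a + b) = e a * e b.
Proof.
by rewrite -[a]natr_Zp -[b]natr_Zp -natrD !addch_nat exprD.
Qed.

Lemma addch0 : e 0 = 1.
Proof. by rewrite -[0]/(0%:R) addch_nat expr0. Qed.

Lemma norm_addch a : `|e a| = 1.
Proof.
have z1 : `|z| = 1.
  apply/eqP; rewrite -(@pexpr_eq1 _ _ p) ?prime_gt0//.
  by rewrite -normrX (prim_expr_order z_prim) normr1.
by rewrite normrX z1 expr1n.
Qed.

Lemma addch_conj a : (e a)^* = e (- a).
Proof.
have nz : e a != 0 by rewrite -normr_eq0 norm_addch oner_eq0.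
apply: (mulfI nz); rewrite -addchD subrr addch0.
by rewrite -normCK norm_addch expr1n.
Qed.

Lemma addch_sum (I : finType) (f : I -> F) : e (\sum_i f i) = \prod_i e (f i).
Proof.
by apply: (big_morph e addchD addch0).
Qed.

Lemma addch_eq1 a : (e a == 1) = (a == 0).
Proof.
apply/idP/eqP => [|->]; last by rewrite addch0.
rewrite /addch -(prim_order_dvd z_prim) => pa.
apply: val_inj => /=.
have := ltn_ord a; rewrite [X in (_ < X)%N](_ : _ = p); last first.
  by rewrite -[RHS](card_Fp p_prime) card_ord.
move=> ap; move: pa; case: (posnP a) => [->//|a_gt0].
by move=> /(dvdn_leq a_gt0); rewrite leqNgt ap.
Qed.

Lemma sum_addch a : \sum_s e (s * a) = if a == 0 then p%:R else 0.
Proof.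
have [->|a0] := eqVneq a 0.
  rewrite (eq_bigr (fun=> 1)) => [|s _]; last by rewrite mulr0 addch0.
  by rewrite sumr_const card_Fp.
set S := \sum_s _.
have : S * e a = S.
  rewrite /S big_distrl /= [RHS](reindex_inj (addIr 1)) /=.
  by apply: eq_bigr => s _; rewrite mulrDl mul1r addchD.
move/eqP; rewrite -subr_eq0 -[X in _ - X]mulr1 -mulrBr mulf_eq0 subr_eq0.
by rewrite addch_eq1 (negPf a0) orbF => /eqP.
Qed.

Variable l : nat.
Hypothesis l_gt0 : (0 < l)%N.

Definition gsum (s : F) : algC := \sum_x e (s * x ^+ l).
Local Notation G := gsum.

Definition nsol (m : F) : nat :=
  #|[pred x : {ffun 'I_l -> F} | \sum_i x i ^+ l == m]|.

Lemma gsum0 : G 0 = p%:R.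
Proof.
rewrite /gsum (eq_bigr (fun=> 1)) => [|s _]; last by rewrite mul0r addch0.
by rewrite sumr_const card_Fp.
Qed.

Lemma gsum_conj s : (G s)^* = G (- s).
Proof.
rewrite /gsum rmorph_sum /=; apply: eq_bigr => x _.
by rewrite addch_conj mulNr.
Qed.

Lemma gsum_scale s y : y != 0 -> G (s * y ^+ l) = G s.
Proof.
move=> y0; rewrite /gsum [RHS](reindex_inj (mulfI y0)) /=.
by apply: eq_bigr => x _; rewrite exprMn mulrA.
Qed.

(** Orthogonality of the additive characters detects the equation, and the sum over tuples factors
    into the l-th power of one Gauss sum. *)
Lemma nsolE m : (p * nsol m)%:R = \sum_s G s ^+ l * e (- (s * m)).
Proof.
under eq_bigr => s _.
  have -> : G s ^+ l = \sum_(x : {ffun 'I_l -> F}) e (s * \sum_i x i ^+ l).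
    rewrite -{1}[l]card_ord -prodr_const bigA_distr_bigA /=.
    apply: eq_bigr => x _; rewrite mulr_sumr addch_sum.
    by apply: eq_bigr => i _.
  rewrite mulr_suml.
  under eq_bigr => x _ do rewrite -addchD -mulrBr.
  over.
rewrite exchange_big /=.
under eq_bigr => x _ do rewrite sum_addch subr_eq0.
rewrite -big_mkcond /= sumr_const /nsol mulnC natrM mulr_natl; congr (_ *+ _).
Qed.

Lemma nsolE0 m :
  (p * nsol m)%:R = (p ^ l)%:R + \sum_(s | s != 0) G s ^+ l * e (- (s * m)).
Proof.
by rewrite nsolE (bigD1 0)//= gsum0 mul0r oppr0 addch0 mulr1 natrX.
Qed.

Lemma card_units : #|[pred y : F | y != 0]| = p.-1.
Proof.
by have := cardC1 (0 : F); rewrite card_Fp.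
Qed.

Lemma sum_units_const (c : algC) : \sum_(y : F | y != 0) c = (p.-1)%:R * c.
Proof. by rewrite sumr_const card_units mulr_natl. Qed.

Lemma sum_addch_pow a : \sum_(y | y != 0) e (a * y ^+ l) = G a - 1.
Proof.
rewrite /gsum [in RHS](bigD1 0)//= expr0n gtn_eqF// mulr0 addch0.
by rewrite addrAC subrr add0r.
Qed.

(* Average the left-hand side over the substitutions s -> s * y ^ l. *)
Lemma sum_invariant (f : F -> algC) m :
  (forall s y, y != 0 -> f (s * y ^+ l) = f s) ->
  (p.-1)%:R * \sum_(s | s != 0) f s * e (- (s * m)) =
  \sum_(s | s != 0) f s * (G (- (s * m)) - 1).
Proof.
move=> f_inv; rewrite -sum_units_const.
transitivity (\sum_(y : F | y != 0) \sum_(s | s != 0)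
    f s * e (- (s * m) * y ^+ l)).
  apply: eq_bigr => y y0.
  rewrite (reindex_inj (mulIf (expf_neq0 l y0))) /=.
  apply: eq_big => s; first by rewrite mulf_eq0 (negPf (expf_neq0 l y0)) orbF.
  by move=> s0; rewrite f_inv//; congr (_ * e _); rewrite mulNr mulrAC.
rewrite exchange_big /=; apply: eq_bigr => s _.
by rewrite -mulr_sumr sum_addch_pow.
Qed.

Lemma parseval :
  \sum_s `|G s| ^+ 2 =
  (p * #|[pred u : F * F | u.1 ^+ l == u.2 ^+ l]|)%:R.
Proof.
transitivity (\sum_s \sum_x \sum_y e (s * (x ^+ l - y ^+ l))).
  apply: eq_bigr => s _; rewrite normCK gsum_conj /G mulr_suml.
  apply: eq_bigr => x _; rewrite mulr_sumr; apply: eq_bigr => y _.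
  by rewrite -addchD mulrBr mulNr.
rewrite exchange_big /=; under eq_bigr => x _ do rewrite exchange_big /=.
rewrite pair_big /=.
under eq_bigr => x _ do rewrite sum_addch subr_eq0.
rewrite -big_mkcond /= sumr_const mulnC natrM mulr_natl; congr (_ *+ _).
Qed.

(** The list [rs] exhausts the l-th roots of unity, so a nonzero x is paired with exactly the l
    elements x r, and 0 only with itself. *)
Lemma card_pow_eq_pairs (rs : seq F) :
  uniq rs -> size rs = l -> all (fun r => r ^+ l == 1) rs ->
  #|[pred u : F * F | u.1 ^+ l == u.2 ^+ l]| = (1 + p.-1 * l)%N.
Proof.
move=> urs srs /allP rs1.
have roots1 x : (x ^+ l == 1) = (x \in rs).
  have sub : {subset rs <= enum [pred x : F | x ^+ l == 1]}.
    by move=> r /rs1; rewrite mem_enum.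
  have [|_ ->] := uniq_min_size urs sub; last by rewrite mem_enum inE.
  by rewrite srs -cardE card_pow_root.
rewrite -sum1_card (eq_bigl (fun u : F * F => (xpredT u.1) && (u.1 ^+ l == u.2 ^+ l)))//.
rewrite -(pair_big_dep xpredT (fun x y => x ^+ l == y ^+ l) (fun _ _ => 1%N)) /=.
rewrite (bigD1 0)//=; congr (_ + _)%N.
  rewrite (eq_bigl (pred1 0)) ?big_pred1_eq// => y.
  by rewrite expr0n gtn_eqF//= eq_sym expf_eq0 l_gt0.
rewrite (eq_bigr (fun=> l)) => [|x x0].
  by rewrite sum_nat_const card_units.
rewrite (reindex_inj (mulfI x0)) /=.
rewrite (eq_bigl (mem rs)) ?sum1_card; first by rewrite -srs; apply/card_uniqP.
move=> y /=; rewrite -roots1 exprMn -{1}[x ^+ l]mulr1.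
by rewrite (inj_eq (mulfI (expf_neq0 l x0))) eq_sym.
Qed.

Lemma parseval_units (rs : seq F) :
  uniq rs -> size rs = l -> all (fun r => r ^+ l == 1) rs ->
  \sum_(s | s != 0) `|G s| ^+ 2 = (p * p.-1 * l.-1)%:R.
Proof.
move=> urs srs ars; have := parseval; rewrite (card_pow_eq_pairs urs srs ars).
rewrite (bigD1 0)//= gsum0 normr_nat -natrX => /(canRL (addKr _)) ->.
have p_gt0 := prime_gt0 p_prime.
rewrite addrC -natrB; last by nia.
by congr (_%:R); nia.
Qed.

End GaussSums.

(** * Sums of three cubes modulo a prime *)

Local Open Scope ring_scope.

Section Cubes.
Variables (p : nat) (p_prime : prime p) (w : 'F_p).
Hypotheses (p_neq3 : p != 3%N) (w_root : w ^+ 2 + w + 1 = 0).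
Variable z : algC.
Hypothesis z_prim : p.-primitive_root z.

Local Notation G := (@gsum p z 3).
Local Notation e := (@addch p z).

Let three_neq0 : (3 : 'F_p) != 0.
Proof.
apply/eqP => h3; have := val_Fp_nat p_prime 3; rewrite h3 => /esym/eqP.
by rewrite -/(dvdn p 3) (dvdn_prime2 p_prime)// (negPf p_neq3).
Qed.

Let w_cube : w ^+ 3 = 1.
Proof.
apply/eqP; rewrite -subr_eq0; apply/eqP.
by rewrite -[RHS](mulr0 (w - 1)) -w_root; ring.
Qed.

Let w_neq1 : w != 1.
Proof.
apply: contra_neq three_neq0 => w1; rewrite -w_root w1; ring.
Qed.

Lemma cubic_parseval :
  \sum_(s : 'F_p | s != 0) `|G s| ^+ 2 = (p * p.-1 * 2)%:R.
Proof.
apply: (@parseval_units p p_prime z z_prim 3 isT [:: 1; w; w ^+ 2]) => //=.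
- rewrite !inE !negb_or andbT eq_sym w_neq1 /=; apply/andP; split.
    apply: contra_neq w_neq1 => w2; move: w_cube.
    by rewrite exprS -w2 mulr1.
  apply: contra_neq w_neq1 => w2.
  have w0 : w != 0 by apply: contra_eq_neq w_cube => ->; rewrite expr0n eq_sym oner_neq0.
  by apply: (mulfI w0); rewrite mulr1 -expr2 -w2.
- by rewrite [w ^+ 2 ^+ 3]exprAC w_cube expr1n eqxx.
Qed.

Lemma cubic_gsumN s : G (- s) = G s.
Proof.
have -> : - s = s * (-1) ^+ 3 by ring.
by rewrite gsum_scale// oppr_eq0 oner_neq0.
Qed.

Lemma cubic_gsum_real s : G s \is Num.real.
Proof. by rewrite CrealE gsum_conj// cubic_gsumN. Qed.

Let normG s : `|G s| ^+ 2 = G s ^+ 2.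
Proof. by rewrite real_normK// cubic_gsum_real. Qed.

Let p1p_gt0 : (0 < p.-1 * p)%N.
Proof. by rewrite muln_gt0 (prime_gt0 p_prime) andbT -ltnS prednK ?prime_gt0 ?prime_gt1. Qed.

Let p1_gt0 : 0 < (p.-1)%:R :> algC.
Proof. by rewrite ltr0n; case/andP: (etrans (esym (muln_gt0 _ _)) p1p_gt0). Qed.

(** G^2 is constant on s times the nonzero cubes, and s y^3 takes each value at most three times; so
    G(s)^2 is at most three times the mean 2 p of G^2. This stands in for Weil's bound. *)
Lemma cubic_gsum_le s : s != 0 -> G s ^+ 2 <= (6 * p)%:R.
Proof.
move=> s0.
have : (p.-1)%:R * G s ^+ 2 <= 3%:R * \sum_(t : 'F_p | t != 0) `|G t| ^+ 2.
  rewrite -sum_units_const//.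
  under eq_bigr => y y0 do rewrite -(gsum_scale z 3 s y0) -normG.
  apply: (sum_fiber_le (f := fun y => s * y ^+ 3) (h := fun t => `|G t| ^+ 2)).
  - by move=> y y0; rewrite mulf_neq0// expf_neq0.
  - by move=> y _; rewrite exprn_ge0.
  - move=> u _; apply: leq_trans (card_pow_root (s^-1 * u) (l := 3) isT).
    apply: subset_leq_card; apply/subsetP => y; rewrite !inE => /andP[_ /eqP<-].
    by rewrite mulrA mulVf// mul1r.
rewrite cubic_parseval -natrM => h; rewrite -(ler_pM2l p1_gt0).
by apply: le_trans h _; rewrite -natrM ler_nat; lia.
Qed.

(** The main part of (p - 1) (p N(m) - p^3), where N(m) is the number of representations of m: by
    [sum_invariant] the two differ by the sum of G^3 over the units. *)
Let Psi (m : 'F_p) := \sum_(s : 'F_p | s != 0) G s ^+ 3 * G (s * m).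

Let Psi_real m : Psi m \is Num.real.
Proof.
by apply: rpred_sum => s _; rewrite rpredM// ?rpredX// cubic_gsum_real.
Qed.

Let Psi_scale m y : y != 0 -> Psi (m * y ^+ 3) = Psi m.
Proof. by move=> y0; apply: eq_bigr => s _; rewrite mulrA gsum_scale. Qed.

(* Cauchy-Schwarz for the second and fourth moments of G. *)
Let Psi1 : (p ^ 2 * p.-1 * 4)%:R <= Psi 1.
Proof.
have -> : Psi 1 = \sum_(s : 'F_p | s != 0) (G s ^+ 2) ^+ 2.
  by apply: eq_bigr => s _; rewrite mulr1 -exprSr -exprM.
rewrite -subr_ge0.
have -> : \sum_(s : 'F_p | s != 0) (G s ^+ 2) ^+ 2 - (p ^ 2 * p.-1 * 4)%:R =
   \sum_(s : 'F_p | s != 0) (G s ^+ 2 - (2 * p)%:R) ^+ 2.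
  set c : algC := (2 * p)%:R.
  have E s : (G s ^+ 2 - c) ^+ 2 = (G s ^+ 2) ^+ 2 - `|G s| ^+ 2 * (2%:R * c) + c ^+ 2.
    by rewrite normG; ring.
  under [RHS]eq_bigr => s _ do rewrite E.
  rewrite big_split sumrB /= sum_units_const// -addrA; congr (_ + _).
  rewrite -mulr_suml cubic_parseval /c !natrM; ring.
apply: sumr_ge0 => s _; rewrite -realEsqr rpredB ?rpredX ?cubic_gsum_real//.
by rewrite realn.
Qed.

Let sum_Psi : \sum_(m : 'F_p | m != 0) Psi m = 0.
Proof.
have Psi0 : \sum_m Psi m = \sum_(s : 'F_p | s != 0) G s ^+ 3 * p%:R.
  rewrite exchange_big /=; apply: eq_bigr => s s0.
  rewrite -mulr_sumr; congr (_ * _).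
  transitivity (\sum_t G t); first by rewrite [RHS](reindex_inj (mulfI s0)).
  rewrite /gsum exchange_big /=.
  rewrite (bigD1 0)// [X in _ _ X = _]big1 => [|x /andP[_ x0]].
    by rewrite sum_addch// expr0n eqxx /= addr0.
  by rewrite sum_addch// expf_eq0 (negPf x0) andbF.
move: Psi0; rewrite (bigD1 0)//= [X in X + _](_ : _ = \sum_(s : 'F_p | s != 0) G s ^+ 3 * p%:R).
  by rewrite -[RHS]addr0 => /addrI.
by apply: eq_bigr => s _; rewrite mulr0 gsum0.
Qed.

(* Psi is large on the nonzero cubes, which make up a third of the units, and has
   sum 0, hence it is very negative somewhere. *)
Let exists_Psi : exists2 m, m != 0 & 2%:R * Psi m <= - (p ^ 2 * p.-1 * 3)%:R.
Proof.
case: (boolP [exists m : 'F_p, (m != 0) && (2%:R * Psi m <= - (p ^ 2 * p.-1 * 3)%:R)]).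
  by move=> /existsP[m /andP[m0 hm]]; exists m.
rewrite negb_exists => /forallP hall.
(* Averaging over the non-cubes would allow 4 in place of 3. The value 3 makes the contradiction
   strict, and it still exceeds the 2 required for a deficit of p; the surplus absorbs the sum of
   G^3 in [cubic_few_sols]. *)
set k : algC := (p ^ 2 * p.-1 * 3)%:R.
have k_gt0 : 0 < k by rewrite ltr0n; have := prime_gt1 p_prime; nia.
have pos m : m != 0 -> 0 <= 2%:R * Psi m + k.
  move=> m0; have := hall m; rewrite m0 /= -real_ltNge ?realN ?realn//.
    by move=> /ltW; rewrite -subr_ge0 opprK.
  by rewrite realM ?realn ?Psi_real.
have : \sum_(y : 'F_p | y != 0) (2%:R * Psi (y ^+ 3) + k)
    <= 3%:R * \sum_(m : 'F_p | m != 0) (2%:R * Psi m + k).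
  apply: (sum_fiber_le (f := fun y => y ^+ 3) (h := fun t => 2%:R * Psi t + k)).
  - by move=> y y0; rewrite expf_neq0.
  - exact: pos.
  - move=> u _; apply: leq_trans (card_pow_root u (l := 3) isT).
    by apply: subset_leq_card; apply/subsetP => y; rewrite !inE => /andP[].
rewrite !big_split /= -!mulr_sumr sum_Psi mulr0 add0r !sum_units_const//.
under eq_bigr => y y0 do rewrite -[y ^+ 3]mul1r Psi_scale//.
rewrite sum_units_const// mulrCA -mulrDr [X in _ <= X]mulrCA (ler_pM2l p1_gt0) => h.
suff : (p ^ 2 * p.-1 * 8)%:R <= 2%:R * k :> algC.
  by rewrite -natrM ler_nat; have := prime_gt1 p_prime; nia.
have h2 : 2%:R * (p ^ 2 * p.-1 * 4)%:R <= 2%:R * Psi 1.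
  by rewrite ler_pM2l ?ltr0n// Psi1.
apply: le_trans (_ : 2%:R * Psi 1 <= _).
  by apply: le_trans h2; rewrite -natrM ler_nat; lia.
have -> : 2%:R * k = 3%:R * k - k by ring.
by rewrite lerBrDr.
Qed.

(** An integer bound for |G|. It is left free since it will be taken proportional to p, far above
    the true size sqrt p. *)
Variable B : nat.
Hypothesis B_large : (6 * p <= B ^ 2)%N.

Let normG_le s : s != 0 -> `|G s| <= B%:R.
Proof.
move=> s0; rewrite -(ler_pXn2r (n := 2)) ?nnegrE ?normr_ge0 ?ler0n//.
by rewrite normG (le_trans (cubic_gsum_le s0))// -natrX ler_nat.
Qed.

Let sum_cube : \sum_(s : 'F_p | s != 0) `|G s| ^+ 3 <= (p * p.-1 * 2 * B)%:R.
Proof.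
apply: le_trans (_ : \sum_(s : 'F_p | s != 0) `|G s| ^+ 2 * B%:R <= _).
  by apply: ler_sum => s s0; rewrite exprSr ler_wpM2l ?exprn_ge0// normG_le.
by rewrite -mulr_suml cubic_parseval -natrM.
Qed.

Lemma cubic_few_sols : (4 * B <= p)%N ->
  exists2 g : 'F_p, g != 0 & (@nsol p 3 g + p <= p ^ 2)%N.
Proof.
move=> Bp; have [g g0 hg] := exists_Psi; exists g => //.
have := congr1 (fun x => (p.-1)%:R * x) (nsolE0 p_prime z_prim 3 g).
rewrite mulrDr (@sum_invariant p p_prime z z_prim 3)//; last first.
  by move=> s y y0; rewrite gsum_scale.
under eq_bigr => s _ do rewrite cubic_gsumN mulrBr mulr1.
rewrite sumrB -/(Psi g) => E1.
have h1 : - \sum_(s : 'F_p | s != 0) G s ^+ 3 <= (p * p.-1 * 2 * B)%:R.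
  apply: le_trans sum_cube; rewrite -sumrN.
  apply: ler_sum => s s0; rewrite -normrX; apply: real_ler_normlW => //=.
    by rewrite realN realX// cubic_gsum_real.
  by rewrite normrN.
have : 2%:R * ((p.-1)%:R * (p * @nsol p 3 g)%:R) <=
   2%:R * ((p.-1)%:R * (p ^ 3)%:R + (p * p.-1 * 2 * B)%:R) - (p ^ 2 * p.-1 * 3)%:R :> algC.
  rewrite E1 !mulrDr -!addrA lerD2l addrC.
  by apply: lerD => //; rewrite ler_pM2l ?ltr0n.
rewrite lerBrDr -!natrM -!natrD -natrM ler_nat => h.
suff : (2 * @nsol p 3 g + 3 * p <= 2 * p ^ 2 + 4 * B)%N.
  by move: (@nsol p 3 g) Bp; clear; lia.
rewrite -(leq_pmul2l p1p_gt0); apply: etrans h; congr (_ <= _)%N; ring.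
Qed.

(** For a single class these moment bounds only give an error of order p, the same as the gain in
    [cubic_few_sols]. Averaging over g y^3 brings in a second factor G - 1, and scaling by cubes can
    then be used once more; this saves another sqrt p. *)
Lemma cubic_average_sols (g h : 'F_p) : g != 0 -> h != 0 ->
  (\sum_(y : 'F_p | y != 0%R) @nsol p 3 (g * y ^+ 3 + h)%R
    <= p ^ 2 * p.-1 + 28 * p * B)%N.
Proof.
move=> g0 h0.
have Gh y : (p * @nsol p 3 (g * y ^+ 3 + h)%R)%:R =
   (p ^ 3)%:R + \sum_(s : 'F_p | s != 0) G s ^+ 3 * e (- (s * h)) * e (- (s * g) * y ^+ 3).
  rewrite (nsolE0 p_prime z_prim); congr (_ + _); apply: eq_bigr => s _.
  rewrite -mulrA; congr (_ * _); rewrite -addchD//; congr (e _); ring.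
pose f (s : 'F_p) := G s ^+ 3 * (G (s * g) - 1).
have E1 : \sum_(y : 'F_p | y != 0) (p * @nsol p 3 (g * y ^+ 3 + h)%R)%:R =
   (p.-1)%:R * (p ^ 3)%:R + \sum_(s : 'F_p | s != 0) f s * e (- (s * h)).
  under eq_bigr => y _ do rewrite Gh.
  rewrite big_split /= sum_units_const//; congr (_ + _).
  rewrite exchange_big /=; apply: eq_bigr => s _.
  by rewrite -mulr_sumr sum_addch_pow// cubic_gsumN /f; ring.
have f_inv s y : y != 0 -> f (s * y ^+ 3) = f s.
  by move=> y0; rewrite /f [s * _ * g]mulrAC !gsum_scale.
have := congr1 (fun x => (p.-1)%:R * x) E1.
rewrite mulrDr (@sum_invariant p p_prime z z_prim 3)// => E2.
set S := \sum_(s : 'F_p | s != 0) f s * _ in E2.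
have bound : `|S| <= (28 * p ^ 2 * p.-1 * B)%:R.
  apply: le_trans (ler_norm_sum _ _ _) _.
  apply: le_trans (_ : \sum_(s : 'F_p | s != 0) `|G s| ^+ 3 * (14 * p)%:R <= _).
    apply: ler_sum => s s0; rewrite /f normrM [X in X * _]normrM normrX -mulrA.
    apply: ler_wpM2l; first by rewrite exprn_ge0.
    have G1 t : t != 0 -> `|G t - 1| ^+ 2 <= (14 * p)%:R.
      move=> t0; rewrite real_normK ?rpredB ?rpred1 ?cubic_gsum_real//.
      apply: le_trans (_ : 2%:R * G t ^+ 2 + 2%:R <= _).
        rewrite -subr_ge0 (_ : _ - _ = (G t + 1) ^+ 2); last by ring.
        by rewrite -realEsqr rpredD ?rpred1 ?cubic_gsum_real.
      apply: le_trans (_ : 2%:R * (6 * p)%:R + 2%:R <= _).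
        by rewrite lerD2r ler_pM2l ?ltr0n// cubic_gsum_le.
      by rewrite -natrM -natrD ler_nat; move: (prime_gt1 p_prime); clear; lia.
    have amgm (a b c : algC) : a \is Num.real -> b \is Num.real ->
        a ^+ 2 <= c -> b ^+ 2 <= c -> a * b <= c.
      move=> ra rb ac bc; rewrite -(ler_pM2l (_ : 0 < 2%:R)) ?ltr0n//.
      apply: le_trans (_ : a ^+ 2 + b ^+ 2 <= _).
        rewrite -subr_ge0 (_ : _ - _ = (a - b) ^+ 2); last by ring.
        by rewrite -realEsqr rpredB.
      by rewrite (_ : 2%:R * c = c + c) ?lerD//; ring.
    by apply: amgm; rewrite ?normr_real// G1 ?oppr_eq0 ?mulf_neq0.
  rewrite -mulr_suml; apply: le_trans (_ : (p * p.-1 * 2 * B)%:R * (14 * p)%:R <= _).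
    by rewrite ler_wpM2r ?ler0n// sum_cube.
  by rewrite -natrM ler_nat leq_eqVlt; apply/orP; left; apply/eqP; ring.
rewrite -natr_sum -big_distrr /= -!natrM in E2.
set X := (\sum_(y : 'F_p | y != 0%R) _)%N in E2 *.
have S_real : S \is Num.real.
  rewrite (_ : S = (p.-1 * (p * X))%:R - (p.-1 * (p.-1 * p ^ 3))%:R); last first.
    by rewrite E2 addrC addKr.
  by rewrite rpredB// realn.
have : (p.-1 * (p * X))%:R <= (p.-1 * (p.-1 * p ^ 3) + 28 * p ^ 2 * p.-1 * B)%:R :> algC.
  rewrite E2 natrD lerD2l; apply: le_trans bound; exact: real_ler_norm.
rewrite ler_nat => le_X; rewrite -(leq_pmul2l p1p_gt0).
by apply: etrans le_X; congr (_ <= _)%N; ring.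
Qed.

End Cubes.

(** * Sums of four fourth powers modulo a prime *)

Local Open Scope ring_scope.

Section Quartics.
Variables (p : nat) (p_prime : prime p) (i : 'F_p).
Hypotheses (i_root : i ^+ 2 = -1) (i_nonsquare : forall x, x ^+ 2 != i).
Variable z : algC.
Hypothesis z_prim : p.-primitive_root z.

Local Notation S := (@gsum p z 4).
Local Notation T := (@gsum p z 2).
Local Notation e := (@addch p z).

Let p1p_gt0 : (0 < p.-1 * p)%N.
Proof. by rewrite muln_gt0 (prime_gt0 p_prime) andbT -ltnS prednK ?prime_gt0 ?prime_gt1. Qed.

Let p1_gt0 : 0 < (p.-1)%:R :> algC.
Proof. by rewrite ltr0n; case/andP: (etrans (esym (muln_gt0 _ _)) p1p_gt0). Qed.

Let i_neq0 : i != 0.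
Proof. by have := i_nonsquare 0; rewrite expr0n eq_sym. Qed.

Let i_neq1 : i != 1.
Proof. by have := i_nonsquare 1; rewrite expr1n eq_sym. Qed.

Let neq_opp1 : (1 : 'F_p) != -1.
Proof.
apply: contra_neq i_neq1 => h; apply/eqP; rewrite -subr_eq0.
have : (i - 1) ^+ 2 = 0.
  rewrite sqrrB i_root -h; rewrite mulr1 expr1n addrAC addrC.
  have -> : (1 : 'F_p) + 1 = 0 by rewrite {1}h addNr.
  by rewrite mulr2n -{1}[i]mul1r {1}h mulN1r addNr oppr0 addr0.
by move/eqP; rewrite expf_eq0.
Qed.

(* i is a nonsquare, so that u and u / i are not both squares. *)
Let halves_card (u : 'F_p) :
  (#|[pred x : 'F_p | x ^+ 2 == u]| + #|[pred x : 'F_p | (i * x ^+ 2)%R == u]| = 2)%N.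
Proof.
pose n (u : 'F_p) := (#|[pred x : 'F_p | x ^+ 2 == u]| +
  #|[pred x : 'F_p | (i * x ^+ 2)%R == u]|)%N.
have n_le2 v : (n v <= 2)%N.
  rewrite /n; have [->|v0] := eqVneq v 0.
    have E1 : #|[pred x : 'F_p | x ^+ 2 == 0]| = 1%N.
      by rewrite (eq_card (B := pred1 0)) ?card1// => x; rewrite !inE expf_eq0.
    have E2 : #|[pred x : 'F_p | (i * x ^+ 2)%R == 0]| = 1%N.
      rewrite (eq_card (B := pred1 0)) ?card1// => x.
      by rewrite !inE mulf_eq0 (negPf i_neq0) expf_eq0.
    by rewrite E1 E2.
  case: (pickP [pred x : 'F_p | x ^+ 2 == v]) => [x /= /eqP xv|none].
    rewrite [X in (_ + X)%N]eq_card0 ?addn0 ?card_pow_root// => y; rewrite !inE.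
    apply: contraNF (i_nonsquare (x / y)) => /eqP yv.
    have y0 : y != 0.
      by apply: contraNneq v0 => y0; rewrite -yv y0 expr0n mulr0.
    by rewrite expr_div_n xv -yv mulfK// expf_neq0.
  rewrite [X in (X + _)%N]eq_card0 ?add0n => [|y]; last exact: none.
  apply: leq_trans (card_pow_root (i^-1 * v) (l := 2) isT).
  apply: subset_leq_card; apply/subsetP => y; rewrite !inE => /eqP <-.
  by rewrite mulrA mulVf// mul1r.
have sumcard (f : 'F_p -> 'F_p) : (\sum_v #|[pred x : 'F_p | f x == v]| = p)%N.
  rewrite -[RHS](card_Fp p_prime) -[RHS]sum1_card [RHS](partition_big f xpredT)//=.
  by apply: eq_bigr => v _; rewrite -sum1_card; apply: eq_bigl => x; rewrite !inE.
have sum_n : (\sum_v n v = \sum_(v : 'F_p) 2)%N.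
  by rewrite big_split /= !sumcard sum_nat_const card_Fp// muln2 addnn.
have : (\sum_v (2 - n v) = 0)%N.
  by rewrite sumnB ?sum_n ?subnn.
move/eqP; rewrite sum_nat_eq0 => /forallP/(_ u) /=.
by rewrite subn_eq0 => h; apply/eqP; rewrite eqn_leq h n_le2.
Qed.

Let sum_halves (h : 'F_p -> algC) :
  \sum_x h (x ^+ 2) + \sum_x h (i * x ^+ 2) = 2%:R * \sum_u h u.
Proof.
have part (f : 'F_p -> 'F_p) :
    \sum_x h (f x) = \sum_u #|[pred x : 'F_p | f x == u]|%:R * h u.
  rewrite (partition_big f xpredT)//=; apply: eq_bigr => u _.
  rewrite (eq_bigr (fun=> h u)) => [|x /eqP->//].
  by rewrite sumr_const mulr_natl.
rewrite (part (fun x => x ^+ 2)) (part (fun x => i * x ^+ 2)) -big_split /=.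
rewrite mulr_sumr; apply: eq_bigr => u _.
by rewrite -mulrDl -natrD halves_card.
Qed.

Let halves (y : 'F_p) : y != 0 ->
  exists2 x, x != 0 & (y = x ^+ 2) \/ (y = i * x ^+ 2).
Proof.
move=> y0; case: (pickP [pred x : 'F_p | x ^+ 2 == y]) => [x /= /eqP xy|none].
  exists x; last by left.
  by apply: contraNneq y0 => x0; rewrite -xy x0 expr0n.
have := halves_card y; rewrite eq_card0// add0n.
case: (pickP [pred x : 'F_p | (i * x ^+ 2)%R == y]) => [x /= /eqP xy _|none'].
  exists x; last by right.
  by apply: contraNneq y0 => x0; rewrite -xy x0 expr0n mulr0.
by rewrite eq_card0.
Qed.

(** The quadratic Gauss sum is real because -1 = i^2 is a square, and it changes sign under s -> s i
    because squares and i times squares together cover the field twice. So T^2 is constant on the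
    units and equals its mean, given by Parseval. *)
Let normT s : s != 0 -> T s ^+ 2 = p%:R.
Proof.
have T_conj t : (T t)^* = T t.
  by rewrite gsum_conj// -[T t](gsum_scale z 2 t i_neq0) i_root mulrN1.
have T_i t : t != 0 -> T (t * i) = - T t.
  move=> t0; apply/eqP; rewrite -addr_eq0 addrC; apply/eqP.
  have := sum_halves (fun u => e (t * u)).
  under [X in _ + X]eq_bigr => x _ do rewrite mulrA.
  rewrite -/(T t) -/(T (t * i)) => ->.
  under eq_bigr => u _ do rewrite mulrC.
  by rewrite sum_addch// (negPf t0) mulr0.
have T_1 t : t != 0 -> T t ^+ 2 = T 1 ^+ 2.
  move=> t0; have [x x0 [->|->]] := halves t0.
    by rewrite -{1}[x ^+ 2]mul1r gsum_scale.
  by rewrite gsum_scale// -[X in T X]mul1r T_i ?oner_neq0// sqrrN.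
move=> s0; rewrite T_1//; apply: (mulfI (lt0r_neq0 p1_gt0)).
have : \sum_(s : 'F_p | s != 0) `|T s| ^+ 2 = (p * p.-1 * 1)%:R.
  apply: (@parseval_units p p_prime z z_prim 2 isT [:: 1; -1]) => //=.
    by rewrite inE neq_opp1.
  by rewrite sqrrN !expr1n eqxx.
under eq_bigr => t t0 do rewrite normCK T_conj -expr2 (T_1 t t0).
by rewrite sum_units_const// muln1 mulnC natrM => ->.
Qed.

Lemma quartic_parseval : \sum_(s : 'F_p | s != 0) `|S s| ^+ 2 = (p * p.-1 * 3)%:R.
Proof.
apply: (@parseval_units p p_prime z z_prim 4 isT [:: 1; -1; i; - i]) => //=.
  have i_neqN1 : i != -1.
    apply: contra_neq neq_opp1 => iN1; rewrite -i_root iN1.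
    by rewrite sqrrN expr1n.
  have i_neqNi : i != - i.
    apply: contra_neq neq_opp1 => iNi; rewrite -i_root expr2 {1}iNi mulNr.
    by rewrite -expr2 i_root opprK.
  rewrite !inE !negb_or !andbT neq_opp1 i_neqNi eqr_opp eq_sym i_neq1.
  by rewrite [1 == _]eq_sym eqr_oppLR [-1 == i]eq_sym i_neqN1.
have i4 : i ^+ 4 = 1 by rewrite -[4%N]/(2 * 2)%N exprM i_root sqrrN expr1n.
by rewrite -[4%N]/(2 * 2)%N !exprM !sqrrN !expr1n -!exprM i4 eqxx.
Qed.

Let normSN s : `|S (- s)| = `|S s|.
Proof. by rewrite -gsum_conj// norm_conjC. Qed.

(** As x^4 = (x^2)^2 and - x^4 = (i x^2)^2, the two sums S(s) and S(-s) together run twice over all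
    squares u^2: their sum is 2 T(s). *)
Let SNE s : s != 0 -> (S s + S (- s)) ^+ 2 = (4 * p)%:R.
Proof.
move=> s0; have -> : S s + S (- s) = 2%:R * T s.
  have := sum_halves (fun u => e (s * u ^+ 2)).
  move=> <-; congr (_ + _); apply: eq_bigr => x _; congr (e _).
    by rewrite -exprM.
  by rewrite exprMn i_root -exprM mulN1r mulNr mulrN.
by rewrite exprMn normT// natrM; ring.
Qed.

(* With S = T + D and T real, D purely imaginary, b s is |D|^2. *)
Let b s := `|S s| ^+ 2 - p%:R.

Let mulSN s : S s * S (- s) = p%:R + b s.
Proof. by rewrite /b addrC subrK -gsum_conj// -normCK. Qed.

Let b_ge0 s : s != 0 -> 0 <= b s.
Proof.
move=> s0; rewrite subr_ge0.
have : `|S s + S (- s)| ^+ 2 <= (`|S s| + `|S (- s)|) ^+ 2.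
  by rewrite ler_pXn2r ?nnegrE ?normr_ge0 ?addr_ge0 ?normr_ge0// ler_normD.
rewrite -normrX SNE// normr_nat normSN (_ : _ ^+ 2 = 4%:R * `|S s| ^+ 2); last by ring.
by rewrite natrM ler_pM2l ?ltr0n.
Qed.

Let sum_b : \sum_(s : 'F_p | s != 0) b s = (p * p.-1 * 2)%:R.
Proof.
by rewrite sumrB quartic_parseval sum_units_const// !natrM; ring.
Qed.

Let b_scale s y : y != 0 -> b (s * y ^+ 2) = b s.
Proof.
move=> y0; rewrite /b; congr (_ ^+ 2 - _).
have [x x0 [->|->]] := halves y0.
  by rewrite -exprM gsum_scale.
by rewrite exprMn i_root -exprM mulN1r mulrN normSN gsum_scale.
Qed.

(** [b] is invariant under s -> s y^2, which takes each value at most twice; so b(s) is at most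
    twice the mean 2 p. *)
Let b_le s : s != 0 -> b s <= (4 * p)%:R.
Proof.
move=> s0.
have : (p.-1)%:R * b s <= 2%:R * \sum_(t : 'F_p | t != 0) b t.
  rewrite -sum_units_const//.
  under eq_bigr => y y0 do rewrite -(b_scale s y0).
  apply: (sum_fiber_le (f := fun y => s * y ^+ 2) (h := b)).
  - by move=> y y0; rewrite mulf_neq0// expf_neq0.
  - by move=> y; apply: b_ge0.
  - move=> u _; apply: leq_trans (card_pow_root (s^-1 * u) (l := 2) isT).
    apply: subset_leq_card; apply/subsetP => y; rewrite !inE => /andP[_ /eqP<-].
    by rewrite mulrA mulVf// mul1r.
rewrite sum_b -natrM => h; rewrite -(ler_pM2l p1_gt0).
apply: le_trans h _; rewrite -natrM ler_nat leq_eqVlt; apply/orP; left.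
by apply/eqP; ring.
Qed.

(** From (S(s) + S(-s))^2 = 4 p and S(s) S(-s) = p + b one gets S(s)^4 + S(-s)^4 = 2 p^2 - 12 p b +
    2 b^2, which is at most 2 p^2 - 4 p b because 0 <= b <= 4 p. As b has mean 2 p, this is negative
    on average. *)
Let sum_quartic :
  \sum_(s : 'F_p | s != 0) S s ^+ 4 <= - (3 * p ^ 2 * p.-1)%:R.
Proof.
rewrite -(ler_pM2l (_ : 0 < 2%:R)) ?ltr0n//.
have -> : 2%:R * \sum_(s : 'F_p | s != 0) S s ^+ 4 =
    \sum_(s : 'F_p | s != 0) (S s ^+ 4 + S (- s) ^+ 4).
  rewrite big_split /= mulr_natl mulr2n; congr (_ + _).
  rewrite (reindex_inj (@oppr_inj 'F_p)) /=.
  by apply: eq_bigl => s; rewrite oppr_eq0.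
apply: le_trans (_ : \sum_(s : 'F_p | s != 0)
     ((2 * p ^ 2)%:R - (4 * p)%:R * b s) <= _).
  apply: ler_sum => s s0.
  have -> : S s ^+ 4 + S (- s) ^+ 4 =
     ((S s + S (- s)) ^+ 2 - 2%:R * (S s * S (- s))) ^+ 2 -
       2%:R * (S s * S (- s)) ^+ 2 by ring.
  rewrite SNE// mulSN -subr_ge0.
  rewrite (_ : _ - _ = 2%:R * (b s * ((4 * p)%:R - b s))); last first.
    by rewrite !natrM ?natrX; ring.
  by rewrite mulr_ge0 ?ler0n// mulr_ge0 ?b_ge0// subr_ge0 b_le.
rewrite sumrB -mulr_sumr sum_b sum_units_const//.
rewrite (_ : _ - _ = 2%:R * - (3 * p ^ 2 * p.-1)%:R)//.
by rewrite !natrM ?natrX; ring.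
Qed.

Lemma quartic_few_sols : (@nsol p 4 0%R + p ^ 2 <= p ^ 3)%N.
Proof.
have := nsolE0 p_prime z_prim 4 0.
under eq_bigr => s _ do rewrite mulr0 oppr0 addch0// mulr1.
move=> E.
have : (p * @nsol p 4 0%R)%:R + (3 * p ^ 2 * p.-1)%:R <= (p ^ 4)%:R :> algC.
  by rewrite E -lerBrDr lerD2l.
rewrite -natrD ler_nat; move: (@nsol p 4 0%R) (prime_gt1 p_prime).
clear => N p_gt1 h.
rewrite -(leq_pmul2l (ltnW p_gt1)); apply: leq_trans (leq_trans h _).
  by rewrite mulnDr leq_add2l; nia.
by rewrite leq_eqVlt; apply/orP; left; apply/eqP; ring.
Qed.

Variable B : nat.
Hypothesis B_large : (5 * p <= B ^ 2)%N.

(** Unlike for cubes a single class suffices: one use of the scaling invariance leaves an error of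
    order p B, against a gain of p^2 in the class of 0. *)
Lemma quartic_sols_le (h : 'F_p) : h != 0 ->
  (@nsol p 4 h <= p ^ 3 + 15 * p * B.+1)%N.
Proof.
move=> h0.
have S2_le s : s != 0 -> `|S s| ^+ 2 <= (5 * p)%:R.
  move=> s0; have := b_le s0; rewrite lerBlDr => /le_trans; apply.
  by rewrite -natrD ler_nat; clear; lia.
have S_le s : s != 0 -> `|S s| <= B%:R.
  move=> s0; rewrite -(ler_pXn2r (n := 2)) ?nnegrE ?normr_ge0 ?ler0n//.
  by rewrite (le_trans (S2_le s s0))// -natrX ler_nat.
have := congr1 (fun x => (p.-1)%:R * x) (nsolE0 p_prime z_prim 4 h).
rewrite mulrDr (@sum_invariant p p_prime z z_prim 4)//; last first.
  by move=> s y y0; rewrite gsum_scale.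
set R := \sum_(s : 'F_p | s != 0) _; rewrite -!natrM => E.
have bound : `|R| <= (5 * p * (p * p.-1 * 3) * B.+1)%:R.
  apply: le_trans (ler_norm_sum _ _ _) _.
  apply: le_trans (_ : \sum_(s : 'F_p | s != 0) (5 * p * B.+1)%:R * `|S s| ^+ 2 <= _).
    apply: ler_sum => s s0; rewrite normrM normrX mulrC natrM.
    have -> : `|S s| ^+ 4 = `|S s| ^+ 2 * `|S s| ^+ 2 by rewrite -exprD.
    rewrite mulrA ler_wpM2r ?exprn_ge0// mulrC; apply: ler_pM; rewrite ?exprn_ge0//.
      exact: S2_le.
    apply: le_trans (ler_normB _ _) _; rewrite normr1 -[B.+1%:R]natr1 lerD2r.
    by rewrite S_le// oppr_eq0 mulf_neq0.
  rewrite -mulr_sumr quartic_parseval -natrM ler_nat leq_eqVlt.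
  by apply/orP; left; apply/eqP; ring.
have R_real : R \is Num.real.
  rewrite (_ : R = (p.-1 * (p * @nsol p 4 h))%:R - (p.-1 * p ^ 4)%:R).
    by rewrite rpredB// realn.
  by rewrite E addrC addKr.
have : (p.-1 * (p * @nsol p 4 h))%:R <=
    (p.-1 * p ^ 4 + 5 * p * (p * p.-1 * 3) * B.+1)%:R :> algC.
  rewrite E natrD lerD2l; apply: le_trans bound; exact: real_ler_norm.
rewrite ler_nat => le_X; rewrite -(leq_pmul2l p1p_gt0).
by apply: etrans le_X; congr (_ <= _)%N; ring.
Qed.

End Quartics.

(** * Biased residue classes *)

Local Open Scope ring_scope.

Lemma nsol_scale (p l : nat) (p_prime : prime p) (m y : 'F_p) : y != 0 ->
  nsol l (m * y ^+ l) = nsol l m.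
Proof.
move=> y0; rewrite /nsol -!sum1_card.
pose f (x : {ffun 'I_l -> 'F_p}) := [ffun i => x i * y].
have f_inj : injective f.
  move=> x x' /ffunP ff; apply/ffunP => i; have := ff i; rewrite !ffunE.
  exact: mulIf.
rewrite (reindex_inj f_inj) /=; apply: eq_bigl => x; rewrite !inE.
under eq_bigr => i _ do rewrite ffunE exprMn.
by rewrite -mulr_suml (inj_eq (mulIf (expf_neq0 l y0))).
Qed.

Local Open Scope nat_scope.

Definition nsol_mod (l M n : nat) : nat :=
  #|[pred x : {ffun 'I_l -> 'I_M} | \sum_i x i ^ l == n %[mod M]]|.

Lemma natr_Fp_eq (p m n : nat) : prime p ->
  (m%:R == n%:R :> 'F_p)%R = (m == n %[mod p]).
Proof.
move=> p_prime; apply/eqP/eqP => [h|h]; last first.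
  by rewrite -(Fp_nat_mod p_prime) h Fp_nat_mod.
by rewrite -!val_Fp_nat// h.
Qed.

Lemma nsol_mod_le (l p n : nat) : prime p -> nsol_mod l p n <= @nsol p l n%:R%R.
Proof.
move=> p_prime; rewrite /nsol_mod /nsol.
pose f (x : {ffun 'I_l -> 'I_p}) : {ffun 'I_l -> 'F_p} :=
  [ffun i => (x i : nat)%:R%R].
have f_inj : injective f.
  move=> x x' /ffunP ff; apply/ffunP => i; have := ff i; rewrite !ffunE => /eqP.
  by rewrite natr_Fp_eq// !modn_small// => /eqP h; apply: val_inj.
rewrite -(card_imset _ f_inj); apply: subset_leq_card; apply/subsetP => _ /imsetP[x xn ->].
move: xn; rewrite !inE -natr_Fp_eq// natr_sum => /eqP <-; apply/eqP.
by apply: eq_bigr => i _; rewrite ffunE natrX.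
Qed.

(* The conditions amount to p = 1 mod 3 for cubes and p = 5 mod 8 for fourth
   powers. *)
Definition biased_prime (l p : nat) : bool :=
  if l == 3 then (p != 3) && [exists w : 'F_p, (w ^+ 2 + w + 1 == 0)%R]
  else [exists i : 'F_p, (i ^+ 2 == -1)%R && [forall x : 'F_p, (x ^+ 2 != i)%R]].

(** [R] lists the candidates for the rare residue: the coset of the g y^3, with repetitions, for
    cubes, and 0 alone for fourth powers. Both bounds concern the average over [R] after a shift by
    h. *)
Lemma local_bias (l E : nat) : l = 3 \/ l = 4 -> 0 < E ->
  exists p0, forall p, p0 <= p -> prime p -> biased_prime l p ->
  exists R : seq nat, [/\ 0 < size R,
    forall h, p %| h -> \sum_(r <- R) nsol_mod l p (r + h) + size R * p ^ (l - 2)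
       <= size R * p ^ (l - 1) &
    forall h, ~~ (p %| h) -> E * \sum_(r <- R) nsol_mod l p (r + h)
       <= size R * (E * p ^ (l - 1) + p ^ (l - 2))].
Proof.
move=> [->|->] E_gt0.
  exists (28 * E * (400 * E) + 2) => p p_ge p_prime /andP[p3 /existsP[w /eqP w_root]].
  have p_gt1 := prime_gt1 p_prime.
  have [z z_prim] := C_prim_root_exists (prime_gt0 p_prime).
  (* The largest value for which the error 28 p B is at most p (p - 1) / E. Being linear in p, it
     satisfies 6 p <= B^2 once B >= 400 E, which is what the threshold on p ensures. *)
  pose B := (p.-1 %/ (28 * E)).
  have B_le : 28 * E * B <= p.-1 by rewrite mulnC leq_trunc_div.
  have B_ge : 400 * E <= B.
    by rewrite leq_divRL; [move: p_ge; clear; lia | rewrite muln_gt0].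
  have p_lt : p.-1 < 28 * E * B.+1 by rewrite mulnC ltn_ceil// muln_gt0.
  have B_large : 6 * p <= B ^ 2.
    move: p_lt B_ge E_gt0 p_gt1; clear; move: B => B; nia.
  have B_small : 4 * B <= p.
    move: B_le E_gt0; clear; move: B => B; nia.
  have [g g0 gfew] := cubic_few_sols p_prime p3 w_root z_prim B_large B_small.
  pose R := [seq (g * y ^+ 3 : 'F_p)%R : nat | y <- enum [pred y : 'F_p | y != 0%R]].
  have sR : size R = p.-1 by rewrite size_map -cardE card_units.
  have sumR h : \sum_(r <- R) nsol_mod 3 p (r + h) <=
      \sum_(y : 'F_p | y != 0%R) @nsol p 3 (g * y ^+ 3 + h%:R)%R.
    rewrite big_map big_enum_cond /=.
    rewrite [X in X <= _](eq_bigl (fun y : 'F_p => y != 0%R)) => [|y]; last by rewrite andbT.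
    apply: leq_sum => y _; apply: leq_trans (nsol_mod_le _ _ _) _ => //.
    by rewrite natrD (natr_Zp (g * y ^+ 3)%R).
  exists R; rewrite !sR; split.
  - by move: p_gt1; clear; lia.
  - move=> h ph; apply: leq_trans (_ : p.-1 * (@nsol p 3 g + p) <= _); last first.
      by rewrite leq_mul2l gfew orbT.
    rewrite mulnDr leq_add2r; apply: leq_trans (sumR h) _.
    have -> : (h%:R = 0 :> 'F_p)%R.
      by apply/eqP; rewrite -[0%R]/(0%:R)%R natr_Fp_eq// mod0n -/(dvdn p h).
    under eq_bigr => y y0 do rewrite GRing.addr0 nsol_scale//.
    by rewrite sum_nat_const card_units.
  - move=> h ph.
    have h0 : (h%:R != 0 :> 'F_p)%R.
      by rewrite -[0%R]/(0%:R)%R natr_Fp_eq// mod0n -/(dvdn p h).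
    have := cubic_average_sols p_prime p3 w_root z_prim B_large g0 h0.
    move=> /(leq_trans (sumR h)) le_sum.
    apply: leq_trans (_ : E * (p ^ 2 * p.-1 + 28 * p * B) <= _).
      by rewrite leq_mul2l le_sum orbT.
    have : p * (28 * E * B) <= p * p.-1 by rewrite leq_mul2l B_le orbT.
    move=> le_B; rewrite [E * _](_ : _ = E * p ^ 2 * p.-1 + p * (28 * E * B)); last by ring.
    apply: leq_trans (leq_add (leqnn _) le_B) _.
    by rewrite leq_eqVlt -[3 - 1]/2 -[3 - 2]/1; apply/orP; left; apply/eqP; ring.
exists (15 * E * (150 * E) + 2) => p p_ge p_prime /existsP[i /andP[/eqP i_root /forallP i_nonsquare]].
have p_gt1 := prime_gt1 p_prime.
have [z z_prim] := C_prim_root_exists (prime_gt0 p_prime).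
(* The predecessor, because the error 15 p (B + 1) is to be at most p^2 / E. *)
pose B := (p %/ (15 * E)).-1.
have B_ge : 150 * E <= B.+1.
  apply: leq_trans (leqSpred _).
  by rewrite leq_divRL; [move: p_ge; clear; lia | rewrite muln_gt0].
have BE : B.+1 = p %/ (15 * E).
  by rewrite /B prednK// divn_gt0 ?muln_gt0//; move: p_ge E_gt0; clear; nia.
have B_le : 15 * E * B.+1 <= p by rewrite BE mulnC leq_trunc_div.
have p_lt : p < 15 * E * B.+2 by rewrite BE mulnC ltn_ceil// muln_gt0.
have B_large : 5 * p <= B ^ 2.
  move: p_lt B_ge E_gt0 p_gt1; clear; move: B => B; nia.
exists [:: 0] => /=; rewrite !mul1n; split=> // h ph.
  rewrite big_seq1 add0n; apply: leq_trans (quartic_few_sols p_prime i_root i_nonsquare z_prim).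
  rewrite leq_add2r; apply: leq_trans (nsol_mod_le _ _ p_prime) _.
  have -> // : (h%:R = 0 :> 'F_p)%R.
  by apply/eqP; rewrite -[0%R]/(0%:R)%R natr_Fp_eq// mod0n -/(dvdn p h).
rewrite big_seq1 add0n.
have h0 : (h%:R != 0 :> 'F_p)%R.
  by rewrite -[0%R]/(0%:R)%R natr_Fp_eq// mod0n -/(dvdn p h).
have le_h := quartic_sols_le p_prime i_root i_nonsquare z_prim B_large h0.
have {}le_h := leq_trans (nsol_mod_le 4 h p_prime) le_h.
apply: leq_trans (_ : E * (p ^ 3 + 15 * p * B.+1) <= _).
  by rewrite leq_mul2l le_h orbT.
have : p * (15 * E * B.+1) <= p * p by rewrite leq_mul2l B_le orbT.
move=> le_B; rewrite [E * _](_ : _ = E * p ^ 3 + p * (15 * E * B.+1)); last by ring.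
by rewrite leq_add2l; apply: leq_trans le_B _; rewrite -mulnn.
Qed.

(** * Combining the biases of many primes *)

Local Open Scope nat_scope.

Lemma nsol_mod_congr (l M n m : nat) : n = m %[mod M] -> nsol_mod l M n = nsol_mod l M m.
Proof. by move=> nm; apply: eq_card => x; rewrite !inE nm. Qed.

Lemma modn_sum_pow (I : finType) (l M : nat) (x y : I -> nat) :
  (forall i, x i = y i %[mod M]) -> \sum_i x i ^ l = \sum_i y i ^ l %[mod M].
Proof.
move=> xy; rewrite -[LHS]modn_summ -[RHS]modn_summ; congr (_ %% _).
by apply: eq_bigr => i _; rewrite -modnXm xy modnXm.
Qed.

Lemma nsol_mod_mul_le (l M p n m : nat) : 0 < M -> 0 < p -> coprime M p ->
  nsol_mod l (M * p) n <= nsol_mod l M n * nsol_mod l p n.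
Proof.
move=> M_gt0 p_gt0 cop.
pose f (x : {ffun 'I_l -> 'I_(M * p)}) :
    {ffun 'I_l -> 'I_M} * {ffun 'I_l -> 'I_p} :=
  ([ffun i => Ordinal (ltn_pmod (x i) M_gt0)],
   [ffun i => Ordinal (ltn_pmod (x i) p_gt0)]).
have f_inj : injective f.
  move=> x x' [/ffunP fM /ffunP fp]; apply/ffunP => i.
  have := fM i; have := fp i; rewrite !ffunE => -[hp] [hM].
  have : x i == x' i %[mod M * p] by rewrite chinese_remainder// hM hp !eqxx.
  by rewrite !modn_small// => /eqP h; apply: val_inj.
rewrite /nsol_mod -(card_imset _ f_inj) -cardX; apply: subset_leq_card.
apply/subsetP => _ /imsetP[x xn ->]; move: xn; rewrite !inE /=.
rewrite chinese_remainder// => /andP[/eqP xM /eqP xp]; apply/andP; split.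
  apply/eqP; rewrite -xM; apply: modn_sum_pow => i.
  by rewrite ffunE /= modn_mod.
apply/eqP; rewrite -xp; apply: modn_sum_pow => i.
by rewrite ffunE /= modn_mod.
Qed.

Local Open Scope ring_scope.

(** Normalized to have mean 1 over the residues n modulo M. *)
Definition density (l M n : nat) : rat := (nsol_mod l M n)%:R / (M ^ (l - 1))%:R.

Lemma density_ge0 l M n : 0 <= density l M n.
Proof. by rewrite divr_ge0 ?ler0n. Qed.

Lemma density_congr (l M n m : nat) : n = m %[mod M] -> density l M n = density l M m.
Proof. by move=> nm; rewrite /density (nsol_mod_congr l nm). Qed.

Lemma density_mul_le (l M p n : nat) : (0 < M)%N -> (0 < p)%N -> coprime M p ->
  density l (M * p) n <= density l M n * density l p n.
Proof.
move=> M_gt0 p_gt0 cop; rewrite /density mulf_div -!natrM -expnMn.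
by rewrite ler_wpM2r ?invr_ge0 ?ler0n// ler_nat nsol_mod_mul_le.
Qed.

Lemma exists_le_average (T : eqType) (R : seq T) (f : T -> rat) (c : rat) :
  (0 < size R)%N -> \sum_(r <- R) f r <= (size R)%:R * c ->
  exists2 r, r \in R & f r <= c.
Proof.
move=> R_gt0 le_sum; apply/hasP; apply: contraLR le_sum => /hasPn R_gt.
have -> : (size R)%:R * c = \sum_(r <- R) c.
  by rewrite big_const_seq count_predT iter_addr_0 mulr_natl.
rewrite -ltNge big_seq [ltRHS]big_seq; apply: ltr_sum => [|r /R_gt].
  by case: (R) R_gt0 => // r0 s _; rewrite /= mem_head.
by rewrite -ltNge.
Qed.

(** Averages over a list, not bounds for one residue: a single r can then be chosen that is good for
    a weighted sum over all shifts at once. *)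
Definition biased (l E p : nat) (R : seq nat) : Prop :=
  [/\ (0 < size R)%N,
    forall h, (p %| h)%N ->
      \sum_(r <- R) density l p (r + h) <= (size R)%:R * (1 - p%:R^-1) &
    forall h, \sum_(r <- R) density l p (r + h) <= (size R)%:R * (1 + (E * p)%:R^-1)].

Lemma local_bias_density (l E : nat) : l = 3%N \/ l = 4%N -> (0 < E)%N ->
  exists p0, forall p, (p0 <= p)%N -> prime p -> biased_prime l p ->
  exists R, biased l E p R.
Proof.
move=> hl E_gt0; have [p0 Hp0] := local_bias hl E_gt0.
exists p0 => p p_ge p_prime p_good.
have [R [R_gt0 R0 Rh]] := Hp0 p p_ge p_prime p_good.
have p_gt0 := prime_gt0 p_prime.
have pow_split : (p ^ (l - 1) = p ^ (l - 2) * p)%N.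
  by case: hl => ->; rewrite -expnSr.
have pw_neq0 : (p ^ (l - 2))%:R != 0 :> rat by rewrite pnatr_eq0 -lt0n expn_gt0 p_gt0.
have p_neq0 : p%:R != 0 :> rat by rewrite pnatr_eq0 -lt0n.
have E_neq0 : E%:R != 0 :> rat by rewrite pnatr_eq0 -lt0n.
have pow_gt0 : 0 < (p ^ (l - 1))%:R :> rat by rewrite ltr0n expn_gt0 p_gt0.
have dens_sum h : \sum_(r <- R) density l p (r + h) =
    (\sum_(r <- R) nsol_mod l p (r + h))%:R / (p ^ (l - 1))%:R.
  by rewrite natr_sum mulr_suml.
have le0 h : (p %| h)%N ->
    \sum_(r <- R) density l p (r + h) <= (size R)%:R * (1 - p%:R^-1).
  move=> ph; rewrite dens_sum ler_pdivrMr//.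
  rewrite [leRHS](_ : _ = (size R * p ^ (l - 1))%:R - (size R * p ^ (l - 2))%:R).
    by rewrite lerBrDr -natrD ler_nat R0.
  by rewrite pow_split !natrM; field.
exists R; split => // h.
have [/le0 ph|ph] := boolP (p %| h)%N.
  apply: le_trans ph _; rewrite ler_wpM2l ?ler0n// lerD2l.
  by apply: le_trans (_ : 0 <= _); rewrite ?oppr_le0 ?invr_ge0 ler0n.
rewrite dens_sum ler_pdivrMr// -(ler_pM2l (_ : 0 < E%:R)) ?ltr0n//.
rewrite [leRHS](_ : _ = (size R * (E * p ^ (l - 1) + p ^ (l - 2)))%:R).
  by rewrite -natrM ler_nat Rh.
by rewrite pow_split !(natrM, natrD); field; rewrite p_neq0.
Qed.

Section Greedy.
Variables (l E K : nat) (rho eta bnd : rat).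
Hypotheses (rho_gt0 : 0 < rho) (eta_gt0 : 0 < eta).
Hypothesis rho_sum : \sum_(k < K) rho ^+ k <= bnd.
Hypotheses (E_gt0 : (0 < E)%N) (E_large : 2%:R * bnd <= eta * E%:R).

Let Phi M n := \sum_(k < K) rho ^+ k * density l M (n + k).

(* The new prime p is spent on the shift k0: the residue of n' mod p is drawn from
   the class that is rarely represented, translated by - k0, and the other shifts
   lose at most a factor 1 + 1 / (E p) on average. *)
Lemma greedy_step (M p n k0 : nat) (R : seq nat) :
  (0 < M)%N -> (0 < p)%N -> coprime M p -> biased l E p R ->
  (k0 < K)%N -> eta <= rho ^+ k0 * density l M (n + k0) -> Phi M n <= bnd ->
  exists n', Phi (M * p) n' <= Phi M n - eta / 2%:R / p%:R.
Proof.
move=> M_gt0 p_gt0 cop [R_gt0 R0 Rh] k0_lt k0_big Phi_le.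
(* The factor p - 1 stands for -1 modulo p, so h k is k - k0 modulo p, and h k0 = p k0. *)
pose h k := (p.-1 * k0 + k)%N.
pose u k := rho ^+ k * density l M (n + k).
have u_ge0 k : 0 <= u k by rewrite mulr_ge0 ?density_ge0// exprn_ge0// ltW.
pose f r := \sum_(k < K) u k * density l p (r + h k).
have [r _ fr] : exists2 r, r \in R & f r <= Phi M n - eta / 2%:R / p%:R.
  apply: exists_le_average => //; rewrite /f exchange_big /=.
  pose k1 := Ordinal k0_lt.
  apply: le_trans (_ : \sum_(k < K) (size R)%:R * (u k * (1 + (E * p)%:R^-1)) -
       (size R)%:R * (u k0 / p%:R) <= _).
    rewrite (bigD1 k1)//= [X in _ <= X - _](bigD1 k1)//= addrAC; apply: lerD.
      rewrite -mulr_sumr -mulrBr.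
      rewrite [X in _ <= _ * X](_ : _ = u k0 * (1 - p%:R^-1 + (E * p)%:R^-1)); last by rewrite /=; ring.
      rewrite [leRHS]mulrCA ler_wpM2l ?u_ge0//; apply: le_trans (R0 _ _) _.
        by rewrite /h -mulSnr prednK// dvdn_mulr.
      by rewrite ler_wpM2l ?ler0n// lerDl invr_ge0 ler0n.
    by apply: ler_sum => k _; rewrite -mulr_sumr [leRHS]mulrCA ler_wpM2l ?u_ge0.
  rewrite -mulr_sumr -mulr_suml -/(Phi M n) -mulrBr ler_wpM2l ?ler0n//.
  have p_r : 0 < p%:R :> rat by rewrite ltr0n.
  have E_r : 0 < E%:R :> rat by rewrite ltr0n.
  (* The total loss Phi / (E p) is at most eta / (2 p) by [E_large], half of the gain eta / p at
     k0. *)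
  apply: le_trans (_ : Phi M n * (1 + (E * p)%:R^-1) - eta / p%:R <= _).
    by rewrite lerB// ler_wpM2r ?invr_ge0 ?ler0n.
  rewrite mulrDr mulr1 -addrA lerD2l -subr_ge0 natrM.
  rewrite [leRHS](_ : _ = (eta * E%:R - 2%:R * Phi M n) / (2%:R * E%:R * p%:R)).
    apply: divr_ge0; last by rewrite !mulr_ge0 ?ler0n.
    by rewrite subr_ge0; apply: le_trans E_large; rewrite ler_pM2l ?ltr0n.
  by field; rewrite !gt_eqF.
exists (chinese M p n (r + p.-1 * k0)); apply: le_trans fr.
apply: ler_sum => k _; rewrite /u -mulrA; apply: ler_wpM2l.
  by rewrite exprn_ge0// ltW.
apply: le_trans (density_mul_le _ _ M_gt0 p_gt0 cop) _.
rewrite (@density_congr l M _ (n + k)); last first.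
  by rewrite -modnDml chinese_modl// modnDml.
rewrite (@density_congr l p _ (r + h k))//.
by rewrite -modnDml chinese_modr// modnDml addnA.
Qed.

(** As long as some weighted shift is at least eta, the next prime lowers the potential [Phi] by eta
    / (2 p). The process may stop early, whence a divisor M of the product in the first case; the
    second will be impossible once the sum of 1/p is large, as [Phi] is nonnegative. *)
Lemma greedy (ps : seq nat) : uniq ps -> all prime ps ->
  (forall p, p \in ps -> exists R, biased l E p R) ->
  (exists M n, [/\ (0 < M)%N, (M %| \prod_(p <- ps) p)%N &
     forall k, (k < K)%N -> rho ^+ k * density l M (n + k) < eta]) \/
  (exists n, Phi (\prod_(p <- ps) p) n <=
     bnd - eta / 2%:R * \sum_(p <- ps) p%:R^-1).
Proof.
elim: ps => [|p ps IH] /=.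
  move=> _ _ _; right; exists 0%N; rewrite !big_nil mulr0 subr0.
  apply: le_trans rho_sum; apply: ler_sum => k _.
  rewrite ler_piMr ?exprn_ge0 ?(ltW rho_gt0)//.
  rewrite /density exp1n divr1 -[1]/(1%:R) ler_nat.
  apply: leq_trans (max_card _) _.
  by rewrite card_ffun !card_ord exp1n.
move=> /andP[p_notin ps_uniq] /andP[p_prime ps_prime] bias.
have p_gt0 := prime_gt0 p_prime.
have [|[M [n [M_gt0 M_dvd Mn]]]|[n n_le]] := IH ps_uniq ps_prime.
- by move=> p' p'_ps; apply: bias; rewrite inE p'_ps orbT.
- left; exists M, n; split=> //; rewrite big_cons; exact: dvdn_mull.
set M := (\prod_(p <- ps) p)%N in n_le *.
have M_gt0 : (0 < M)%N.
  rewrite /M big_seq prodn_cond_gt0// => p' /(allP ps_prime).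
  exact: prime_gt0.
case: (boolP [forall k : 'I_K, rho ^+ k * density l M (n + k) < eta]).
  move=> /forallP small; left; exists M, n; split=> //.
    by rewrite big_cons dvdn_mull.
  by move=> k k_lt; apply: (small (Ordinal k_lt)).
rewrite negb_forall => /existsP[k0]; rewrite -leNgt => k0_big; right.
have [R R_biased] := bias p (mem_head _ _).
have cop : coprime M p.
  rewrite coprime_sym prime_coprime// Euclid_dvd_prod// big_has.
  apply: contra p_notin => /hasP[p' p'_ps].
  by rewrite dvdn_prime2 ?(allP ps_prime p')// => /eqP->.
have sum_ge0 : 0 <= \sum_(p <- ps) p%:R^-1 :> rat.
  by apply: sumr_ge0 => i _; rewrite invr_ge0 ler0n.
have [|n' n'_le] := greedy_step M_gt0 p_gt0 cop R_biased (ltn_ord k0) k0_big.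
  apply: le_trans n_le _; rewrite lerBlDr lerDl mulr_ge0//.
  by rewrite divr_ge0 ?ler0n ?(ltW eta_gt0).
exists n'; rewrite !big_cons mulnC -/M; apply: le_trans n'_le _.
by rewrite mulrDr opprD addrCA addrC lerB.
Qed.
End Greedy.

(** * Divergence of the sum of the reciprocals of the biased primes *)

Local Open Scope nat_scope.

Lemma eq1_mod_of_primes (m n : nat) : 0 < n ->
  (forall p, prime p -> p %| n -> p = 1 %[mod m]) -> n = 1 %[mod m].
Proof.
elim/ltn_ind: n => n IH n_gt0 primes1.
have [->//|n_gt1] : n = 1 \/ 1 < n by lia.
have p_prime := pdiv_prime n_gt1.
have := pdiv_dvd n; move: (pdiv n) p_prime => p p_prime /dvdnP[k nE].
have k_gt0 : 0 < k by move: n_gt0; rewrite nE muln_gt0 => /andP[].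
have k_lt : k < n by rewrite nE ltn_Pmulr// prime_gt1.
rewrite nE -modnMm (IH k k_lt k_gt0) ?(primes1 p p_prime) ?nE ?dvdn_mull//.
  by rewrite modnMm.
by move=> p' p'_prime p'k; apply: primes1 => //; rewrite nE dvdn_mulr.
Qed.

Lemma Fp_natr_eq0 (p n : nat) : prime p -> (n%:R == 0 :> 'F_p)%R = (p %| n).
Proof.
by move=> p_prime; rewrite -[0%R]/(0%:R)%R natr_Fp_eq// mod0n.
Qed.

Lemma Fp_intr_eq0 (p : nat) (n : int) : prime p ->
  (n%:~R == 0 :> 'F_p)%R = (p %| `|n|).
Proof.
move=> p_prime; rewrite -(Fp_natr_eq0 _ p_prime).
by case: n => n /=; rewrite ?NegzE ?mulrNz ?oppr_eq0.
Qed.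

Local Open Scope ring_scope.

(** A square root of u would have order 8 in the group of units, so that 8 would divide p - 1. *)
Lemma sqrt_neg1_nonsquare (p : nat) (u : 'F_p) : prime p -> odd p ->
  (p %% 8 != 1)%N -> u ^+ 2 = -1 -> forall x, x ^+ 2 != u.
Proof.
move=> p_prime p_odd p8 u2 x; apply/eqP => xu.
have x4 : x ^+ 4 = -1 by rewrite -[4%N]/(2 * 2)%N exprM xu.
have neq : (-1 : 'F_p) != 1.
  rewrite eq_sym -addr_eq0 -[X in X == _]/(2%:R) (Fp_natr_eq0 _ p_prime).
  by rewrite dvdn_prime2//; apply: contraTneq p_odd => ->.
have x0 : x != 0.
  by apply: contra_eq_neq x4 => ->; rewrite expr0n eq_sym oppr_eq0 oner_neq0.
have xp : x ^+ p.-1 = 1.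
  apply: (mulfI x0); rewrite mulr1 -exprS prednK ?prime_gt0//.
  by have := expf_card x; rewrite card_Fp.
have x8 : x ^+ 8 = 1 by rewrite -[8%N]/(4 * 2)%N exprM x4 sqrrN expr1n.
move: xp; rewrite (divn_eq p.-1 8) exprD mulnC exprM x8 expr1n mul1r.
have : (p.-1 %% 8 = 2 \/ p.-1 %% 8 = 4 \/ p.-1 %% 8 = 6)%N.
  by move: p_odd p8 (prime_gt0 p_prime); clear; lia.
case=> [|[|]] -> h; move/eqP: neq; apply.
- by rewrite -x4 -[4%N]/(2 * 2)%N exprM h expr1n.
- by rewrite -x4 h.
- have : x ^+ 12 = 1 by rewrite -[12%N]/(6 * 2)%N exprM h expr1n.
  by rewrite -[12%N]/(4 * 3)%N exprM x4 exprS sqrrN expr1n mulr1.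
Qed.

Local Open Scope nat_scope.

(** The forms x^2 + 3 y^2 and x^2 + y^2: modulo a prime that divides a value but not y, -3 or -1 is
    a square. With x = 1 mod 12 Q and 2 Q dividing y the values are prime to 12 Q; for odd Q, y is
    twice an odd number, so that x^2 + y^2 = 5 mod 8. *)
Definition form_coef (l : nat) : nat := if l == 3 then 3 else 1.
Definition form_x (Q i : nat) : nat := 12 * Q * i + 1.
Definition form_y (Q j : nat) : nat := 2 * Q * (6 * j + 1).
Definition form_val (l Q i j : nat) : nat :=
  form_x Q i ^ 2 + form_coef l * form_y Q j ^ 2.

Section Form.
Variables (l Q : nat).
Hypotheses (hl : l = 3 \/ l = 4) (Q_odd : odd Q) (Q3 : 3 %| Q).

Local Notation D := (form_coef l).
Local Notation a := (form_x Q).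
Local Notation b := (form_y Q).
Local Notation N := (form_val l Q).

Let N1 i j : N i j = 4 * Q * (6 * i + 36 * Q * i ^ 2 + D * Q * (6 * j + 1) ^ 2) + 1.
Proof. rewrite /form_val /form_x /form_y; ring. Qed.

Let coprime_N p i j : prime p -> p %| N i j -> ~~ (p %| 12 * Q).
Proof.
move=> p_prime pN; apply/negP => p12Q.
have : p %| 4 * Q.
  move: p12Q; rewrite (_ : 12 * Q = 3 * (4 * Q)); last by ring.
  rewrite Euclid_dvdM// => /orP[|//]; rewrite dvdn_prime2// => /eqP->.
  by rewrite dvdn_mull.
move=> p4Q; move: pN; rewrite N1 (dvdn_addr _ (dvdn_mulr _ p4Q)) dvdn1 => /eqP p1.
by rewrite p1 in p_prime.
Qed.

Let ndvd (d p : nat) : ~~ (p %| 12 * Q) -> d %| 12 * Q -> ~~ (p %| d).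
Proof. by move=> h dQ; apply: contra h => pd; apply: dvdn_trans dQ. Qed.

Let good_of_root p (u : 'F_p) : prime p -> ~~ (p %| 12 * Q) ->
  (l = 4 -> p %% 8 != 1) -> (u ^+ 2 = - D%:R)%R -> biased_prime l p.
Proof.
move=> p_prime p12Q p8 u2; rewrite /biased_prime.
have p3 : p != 3.
  by apply: contraNneq p12Q => ->; rewrite dvdn_mulr.
have two_neq0 : (2%:R != 0 :> 'F_p)%R.
  by rewrite Fp_natr_eq0// (ndvd p12Q)// dvdn_mulr.
move: p8 u2; rewrite /form_coef; case: hl => -> /= p8 u2.
  rewrite p3; apply/existsP; exists ((u - 1) / 2%:R)%R.
  rewrite [X in X == _](_ : _ = (u ^+ 2 + 3%:R) / 4%:R)%R; last first.
    by field; rewrite two_neq0 (_ : 4%:R = 2%:R * 2%:R)%R ?mulf_neq0// -natrM.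
  by rewrite u2 addNr mul0r.
apply/existsP; exists u; rewrite u2 eqxx /=; apply/forallP.
apply: sqrt_neg1_nonsquare => //; last exact: p8.
have [p2|//] := even_prime p_prime.
by move: two_neq0; rewrite Fp_natr_eq0// p2.
Qed.

(** For l = 4 the value is 5 mod 8 and hence has a prime factor that is not 1 mod 8. A chosen prime
    dividing y also divides x, a rare event to be counted apart; otherwise x / y is a square root of
    - D. *)
Lemma form_prime_factor i j : exists p, [/\ prime p, p %| N i j, ~~ (p %| 12 * Q) &
  (p %| a i) && (p %| 6 * j + 1) || biased_prime l p && ~~ (p %| b j)].
Proof.
have N_gt1 : 1 < N i j.
  have Q_gt0 : 0 < Q by case: (Q) Q_odd.
  rewrite N1 addn1 ltnS !(muln_gt0, addn_gt0, expn_gt0) Q_gt0 /form_coef.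
  by case: ifP; rewrite ?orbT.
have [p [p_prime pN p8]] : exists p, [/\ prime p, p %| N i j & l = 4 -> p %% 8 != 1].
  case: hl => l_eq.
    exists (pdiv (N i j)); rewrite pdiv_prime// pdiv_dvd; split=> // l4.
    by rewrite l_eq in l4.
  apply: contrapT => none.
  have : N i j = 1 %[mod 8].
    apply: eq1_mod_of_primes; first exact: ltnW.
    move=> p p_prime pN; apply/eqP/negPn/negP => p8; apply: none.
    by exists p; split.
  rewrite /form_val /form_x /form_y /form_coef l_eq /= mul1n (_ : _ + _ =
    (12 * Q * i + 1) ^ 2 + (Q * (6 * j + 1)) ^ 2 * 4); last by ring.
  have odd_sq m : odd m -> m ^ 2 = 1 %[mod 8].
    move=> m_odd; rewrite -modnXm; have : (m %% 8) \in [:: 1; 3; 5; 7].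
      by rewrite !inE; move: m_odd; clear; lia.
    by rewrite !inE => /or4P[] /eqP ->.
  rewrite -modnDm -[_ * 4 %% 8]modnMml !odd_sq//.
    by rewrite oddM Q_odd oddD oddM.
  by rewrite oddD !oddM.
have p12Q := coprime_N p_prime pN.
exists p; split=> //.
have [pb|pb] := boolP (p %| b j).
  rewrite andbF orbF; apply/andP; split.
    move: pN; rewrite /form_val dvdn_addl; first by rewrite Euclid_dvdX// andbT.
    by rewrite dvdn_mull// dvdn_exp.
  move: pb; rewrite /form_y Euclid_dvdM// => /orP[|//].
  by move=> p2Q; have := ndvd p12Q (d := 2 * Q); rewrite p2Q dvdn_mul// => /(_ isT).
rewrite andbT; apply/orP; right.
apply: (@good_of_root p ((a i)%:R / (b j)%:R)%R) => //.
have b0 : ((b j)%:R != 0 :> 'F_p)%R by rewrite Fp_natr_eq0.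
rewrite expr_div_n -!natrX.
have /eqP : ((N i j)%:R = 0 :> 'F_p)%R by apply/eqP; rewrite Fp_natr_eq0.
rewrite /form_val natrD addr_eq0 => /eqP ->.
by rewrite natrM natrX mulNr mulfK// expf_neq0.
Qed.

(* The pairs (x, y) with x = u y mod p form a lattice whose nonzero vectors have
   x^2 + D y^2 >= p, so that each cell of side c contains at most one of them; there
   are two such lattices since u^2 = - D has two roots. *)
Lemma card_root_pairs p I : prime p -> ~~ (p %| 12 * Q) ->
  exists c, [/\ p <= 4 * c ^ 2, 0 < c &
   #|[pred ij : 'I_I * 'I_I | (p %| N ij.1 ij.2) && ~~ (p %| b ij.2)]|
      <= 2 * (I %/ c).+1 ^ 2].
Proof.
move=> p_prime p12Q.
(* The 4 is 1 + D for D <= 3: two pairs in a cell of side c differ by at most c - 1 in each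
   coordinate, where the form is at most 4 (c - 1)^2, less than p when c is minimal. *)
have exc : exists c, p <= 4 * c ^ 2 by exists p; nia.
case: (ex_minnP exc) => c p_le c_min.
have c_gt0 : 0 < c by case: (c) p_le (prime_gt0 p_prime) => //; lia.
have c_lt : 4 * c.-1 ^ 2 < p.
  rewrite ltnNge; apply/negP => /c_min; case: (c) c_gt0 => //= n _; lia.
exists c; split=> //.
set P := [pred ij | _].
case: (pickP P) => [[i0 j0] /= /andP[pN0 pb0]|none]; last by rewrite eq_card0.
pose A i : 'F_p := ((a i)%:R)%R; pose B j : 'F_p := ((b j)%:R)%R.
have B0 j : ~~ (p %| b j) -> B j != 0%R by rewrite /B Fp_natr_eq0.
have NE i j : p %| N i j -> (A i ^+ 2 = - D%:R * B j ^+ 2)%R.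
  move=> pN; have /eqP : ((N i j)%:R = 0 :> 'F_p)%R by apply/eqP; rewrite Fp_natr_eq0.
  rewrite /form_val natrD natrM !natrX addr_eq0 => /eqP ->.
  by rewrite mulNr.
pose u : 'F_p := (A i0 / B j0)%R.
have u2 : (u ^+ 2 = - D%:R)%R.
  by rewrite /u expr_div_n (NE _ _ pN0) mulfK// expf_neq0// B0.
have div_lt (i : 'I_I) : i %/ c < (I %/ c).+1.
  by rewrite ltnS leq_div2r// ltnW.
pose f (ij : 'I_I * 'I_I) : 'I_(I %/ c).+1 * 'I_(I %/ c).+1 * bool :=
  (Ordinal (div_lt ij.1), Ordinal (div_lt ij.2), A ij.1 == u * B ij.2)%R.
have f_inj : {in P &, injective f}.
  move=> [i j] [i' j'] /andP[/= pN pb] /andP[/= pN' pb'] [ei ej es].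
  have [v v2 [vi vi']] : exists2 v, (v ^+ 2 = - D%:R)%R &
      (A i = v * B j)%R /\ (A i' = v * B j')%R.
    have pm k m : p %| N k m -> (A k = u * B m)%R \/ (A k = - u * B m)%R.
      move=> /NE kmE; have : (A k ^+ 2 == (u * B m) ^+ 2)%R.
        by rewrite kmE exprMn u2.
      by rewrite eqf_sqr mulNr => /orP[] /eqP; [left|right].
    move: es; have [e1|ne1] := eqVneq (A i) _; have [e2|ne2] := eqVneq (A i') _ => // _.
      by exists u.
    exists (- u)%R; first by rewrite sqrrN.
    split; [case: (pm _ _ pN) ne1 => // -> | case: (pm _ _ pN') ne2 => // ->];
      by rewrite eqxx.
  have Q12 : ((12 * Q)%:R != 0 :> 'F_p)%R by rewrite Fp_natr_eq0.
  pose di : int := (i%:Z - i'%:Z)%R; pose dj : int := (j%:Z - j'%:Z)%R.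
  have dE : (di%:~R = v * dj%:~R :> 'F_p)%R.
    apply: (mulfI Q12).
    have -> : ((12 * Q)%:R * di%:~R = A i - A i' :> 'F_p)%R.
      by rewrite /A /form_x /di rmorphB /= -!pmulrn !(natrD, natrM); ring.
    rewrite vi vi' -mulrBr mulrCA; congr (_ * _)%R.
    by rewrite /B /form_y /dj rmorphB /= -!pmulrn !(natrD, natrM); ring.
  have : p %| `|(di ^+ 2 + D%:Z * dj ^+ 2)%R|.
    rewrite -Fp_intr_eq0// rmorphD rmorphM !rmorphXn /= dE exprMn v2 mulNr.
    by rewrite -pmulrn addNr.
  rewrite -(gez0_abs (sqr_ge0 di)) -(gez0_abs (sqr_ge0 dj)) !abszX -PoszM -PoszD absz_nat.
  have D_le : 1 <= D <= 3 by rewrite /form_coef; case: ifP.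
  have close m m' : m %/ c = m' %/ c -> (`|m%:Z - m'%:Z| <= c.-1)%N.
    move=> mm; rewrite (divn_eq m c) (divn_eq m' c) mm.
    have := ltn_pmod m c_gt0; have := ltn_pmod m' c_gt0.
    by move: (m %% c) (m' %% c) (m' %/ c * c) c_gt0; clear; lia.
  have {}ei := close _ _ ei; have {}ej := close _ _ ej.
  move: ei ej; rewrite -/di -/dj => di_le dj_le.
  have [sum0 _|sum_gt0 /(dvdn_leq sum_gt0)] := posnP (`|di| ^ 2 + D * `|dj| ^ 2).
    have di0 : `|di| = 0 by move: sum0 D_le; clear; move: (`|di|) (`|dj|) => x y; nia.
    have dj0 : `|dj| = 0 by move: sum0 D_le; clear; move: (`|di|) (`|dj|) => x y; nia.
    by congr (_, _); apply: val_inj => /=; move: di0 dj0; rewrite /di /dj; clear; lia.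
  rewrite leqNgt (leq_ltn_trans _ c_lt)//.
  move: D_le di_le dj_le; clear; move: (`|di|) (`|dj|) c.-1 D => x y k d.
  by move=> /andP[_ d_le] xk yk; nia.
rewrite -(card_in_imset f_inj) (leq_trans (max_card _))//.
by rewrite !card_prod !card_ord card_bool mulnC -mulnn.
Qed.

Lemma card_dvd_affine (p I m k : nat) : prime p -> ~~ (p %| m) ->
  #|[pred i : 'I_I | p %| m * i + k]| <= (I %/ p).+1.
Proof.
move=> p_prime pm.
have div_lt (i : 'I_I) : i %/ p < (I %/ p).+1.
  by rewrite ltnS leq_div2r// ltnW.
pose f i := Ordinal (div_lt i).
have f_inj : {in [pred i : 'I_I | p %| m * i + k] &, injective f}.
  move=> i i'; rewrite !inE => hi hi' [] fii'; apply: val_inj => /=.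
  rewrite (divn_eq i p) (divn_eq i' p) fii'; congr (_ + _).
  have : m * i + k == m * i' + k %[mod p] by rewrite (eqP hi) (eqP hi').
  rewrite eqn_modDr -!(natr_Fp_eq _ _ p_prime) !natrM.
  rewrite (inj_eq (mulfI _)) ?Fp_natr_eq0//.
  by rewrite natr_Fp_eq// => /eqP.
rewrite -(card_in_imset f_inj) (leq_trans (max_card _))//.
by rewrite card_ord.
Qed.

End Form.

Local Open Scope nat_scope.

Section UnionBound.
Variables (l Q : nat).
Hypotheses (hl : l = 3 \/ l = 4) (Q_odd : odd Q) (Q3 : 3 %| Q).

Local Notation a := (form_x Q).
Local Notation b := (form_y Q).
Local Notation N := (form_val l Q).

Definition dividing_pairs I p : nat :=
  #|[pred ij : 'I_I * 'I_I | (p %| a ij.1) && (p %| 6 * ij.2 + 1)]|.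
Definition root_pairs I p : nat :=
  #|[pred ij : 'I_I * 'I_I | (p %| N ij.1 ij.2) && ~~ (p %| b ij.2)]|.

Lemma pairs_union_bound I X : (forall i j : 'I_I, N i j < X) ->
  I * I <= \sum_(0 <= p < X | prime p && ~~ (p %| 12 * Q))
     (dividing_pairs I p + biased_prime l p * root_pairs I p).
Proof.
move=> N_lt.
have cardE (P : pred ('I_I * 'I_I)) : #|[pred ij | P ij]| = \sum_ij P ij.
  by rewrite -sum1_card [LHS]big_mkcond.
have -> : I * I = \sum_(ij : 'I_I * 'I_I) 1.
  by rewrite sum1_card card_prod card_ord.
under eq_bigr => p _ do rewrite /dividing_pairs /root_pairs !cardE big_distrr -big_split.
rewrite exchange_big /=; apply: leq_sum => -[i j] _ /=.
have [p [p_prime pN p12Q pij]] := form_prime_factor hl Q_odd Q3 i j.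
have p_lt : p < X.
  apply: leq_ltn_trans (N_lt i j); apply: dvdn_leq => //.
  by rewrite /form_val /form_x addn1 addn_gt0 expn_gt0.
rewrite big_mkord (bigD1 (Ordinal p_lt)) ?p_prime//= ltn_addr// pN.
by case/orP: pij => [->//|/andP[-> ->]]; rewrite addnC.
Qed.

Lemma dividing_pairs_le I p : prime p -> ~~ (p %| 12 * Q) ->
  dividing_pairs I p <= (p < 6 * I) * (I %/ p).+1 ^ 2.
Proof.
move=> p_prime p12Q; case: (ltnP p (6 * I)) => p_ge; last first.
  rewrite /dividing_pairs eq_card0// => -[i j]; rewrite !inE /= [X in _ && X]gtnNdvd ?andbF//.
    by rewrite addn1.
  by move: (ltn_ord j) p_ge; clear; lia.
rewrite mul1n; pose A := [pred i : 'I_I | p %| 12 * Q * i + 1].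
pose B := [pred j : 'I_I | p %| 6 * j + 1].
have -> : dividing_pairs I p = #|A| * #|B| by rewrite -cardX; apply: eq_card.
have p6 : ~~ (p %| 6) by apply: contra p12Q => /dvdn_trans-> //; rewrite dvdn_mulr.
by rewrite -mulnn leq_mul// card_dvd_affine.
Qed.

End UnionBound.

Local Open Scope ring_scope.

Definition biased_prime_sum (l m n : nat) : rat :=
  \sum_(m <= p < n | prime p && biased_prime l p) p%:R^-1.

Lemma sum_inv_sq_le (k d : nat) : (1 < k)%N ->
  \sum_(k <= p < k + d) (p%:R ^+ 2)^-1 <= (k.-1)%:R^-1 - ((k + d).-1)%:R^-1 :> rat.
Proof.
move=> k_gt1; elim: d => [|d IH]; first by rewrite addn0 big_geq// subrr.
rewrite addnS big_nat_recr ?leq_addr//=.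
have [n kd] : exists n, (k + d = n.+2)%N by exists (k + d).-2; move: k_gt1; clear; lia.
move: IH; rewrite kd; set S := \sum_(k <= p < n.+2) _ => IH /=.
apply: le_trans (lerD IH (lexx _)) _.
rewrite -addrA lerD2l -subr_ge0 /=.
have n1 : (n.+1%:R : rat) = n%:R + 1 by rewrite -natr1.
have n2 : (n.+2%:R : rat) = n%:R + 2%:R by rewrite -addn2 natrD.
rewrite n1 n2.
have n0 : 0 <= n%:R :> rat by rewrite ler0n.
rewrite [leRHS](_ : _ = ((n%:R + 1) * (n%:R + 2%:R) ^+ 2)^-1).
  by rewrite invr_ge0 mulr_ge0 ?exprn_ge0 ?addr_ge0.
by field; rewrite !gt_eqF// ltr_wpDl.
Qed.

Lemma sqrD1_le (R : realFieldType) (x y : R) : 0 <= y -> y <= x ->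
  (y + 1) ^+ 2 <= 2%:R * x ^+ 2 + 2%:R.
Proof.
move=> y0 yx; apply: le_trans (_ : (x + 1) ^+ 2 <= _).
  have x0 := le_trans y0 yx.
  by apply: lerXn2r; rewrite ?nnegrE ?addr_ge0 ?lerD2r.
rewrite -subr_ge0 (_ : _ - _ = (x - 1) ^+ 2) ?sqr_ge0//; ring.
Qed.

Lemma dividing_pairs_le_rat Q I p : (0 < I)%N -> prime p -> ~~ (p %| 12 * Q)%N ->
  (dividing_pairs Q I p)%:R <= (p < 6 * I)%:R * (2%:R * I%:R ^+ 2 * (p%:R ^+ 2)^-1 + 2%:R) :> rat.
Proof.
move=> I_gt0 p_prime p12Q.
apply: le_trans (_ : ((p < 6 * I) * (I %/ p).+1 ^ 2)%:R <= _).
  by rewrite ler_nat dividing_pairs_le.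
rewrite natrM ler_wpM2l ?ler0n// natrX.
have p_gt0 : 0 < p%:R :> rat by rewrite ltr0n prime_gt0.
have div_le : (I %/ p)%:R <= I%:R / p%:R :> rat.
  by rewrite ler_pdivlMr// -natrM ler_nat leq_trunc_div.
rewrite -mulrA -expr_div_n; set x := I%:R / _ in div_le *.
by rewrite -natr1 sqrD1_le// ler0n.
Qed.

Lemma root_pairs_le_rat l Q I p : l = 3%N \/ l = 4%N -> odd Q -> (3 %| Q)%N ->
  prime p -> ~~ (p %| 12 * Q)%N ->
  (root_pairs l Q I p)%:R <= 16%:R * I%:R ^+ 2 * p%:R^-1 + 4%:R :> rat.
Proof.
move=> hl Q_odd Q3 p_prime p12Q.
have [c [p_le c_gt0 card_le]] := card_root_pairs hl Q_odd Q3 I p_prime p12Q.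
apply: le_trans (_ : (2 * (I %/ c).+1 ^ 2)%:R <= _); first by rewrite ler_nat.
have p_gt0 : 0 < p%:R :> rat by rewrite ltr0n prime_gt0.
have c_r : 0 < c%:R :> rat by rewrite ltr0n.
have div_le : (I %/ c)%:R <= I%:R / c%:R :> rat.
  by rewrite ler_pdivlMr// -natrM ler_nat leq_trunc_div.
have d0 : 0 <= (I %/ c)%:R :> rat by rewrite ler0n.
apply: le_trans (_ : 4%:R * (I%:R / c%:R) ^+ 2 + 4%:R <= _).
  rewrite natrM natrX -[(I %/ c).+1%:R]natr1; set x := _ / _.
  rewrite (_ : 4%:R * x ^+ 2 + 4%:R = 2%:R * (2%:R * x ^+ 2 + 2%:R)); last by ring.
  by rewrite ler_pM2l ?ltr0n// sqrD1_le.
have inv_le : (c%:R ^+ 2)^-1 <= 4%:R * p%:R^-1 :> rat.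
  rewrite -[leLHS]mul1r ler_pdivrMr ?exprn_gt0// mulrAC ler_pdivlMr// mul1r.
  by rewrite -natrX -natrM ler_nat.
rewrite lerD2r expr_div_n.
rewrite (_ : 16%:R * _ * _ = 4%:R * (I%:R ^+ 2 * (4%:R * p%:R^-1))); last by ring.
by rewrite ler_pM2l ?ltr0n// ler_wpM2l// exprn_ge0 ?ler0n.
Qed.

Local Open Scope ring_scope.

Lemma biased_prime_sum_ge0 l m n : 0 <= biased_prime_sum l m n.
Proof. by apply: sumr_ge0 => p _; rewrite invr_ge0 ler0n. Qed.

Lemma biased_prime_sum_cat l k m n : (k <= m)%N -> (m <= n)%N ->
  biased_prime_sum l k n = biased_prime_sum l k m + biased_prime_sum l m n.
Proof. by move=> km mn; rewrite /biased_prime_sum (big_cat_nat km mn). Qed.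

Lemma biased_prime_sumE l m n : biased_prime_sum l m n =
  \sum_(0 <= p < n | [&& prime p, biased_prime l p & (m <= p)%N]) p%:R^-1.
Proof.
rewrite /biased_prime_sum (big_nat_widenl m 0)//; apply: eq_bigl => p.
by rewrite andbA.
Qed.

Lemma biased_prime_sum_le l k m n : (k <= m)%N -> biased_prime_sum l m n <= biased_prime_sum l k n.
Proof.
move=> km; have [mn|nm] := leqP m n.
  by rewrite (biased_prime_sum_cat l km mn) lerDr biased_prime_sum_ge0.
by rewrite [X in X <= _]/biased_prime_sum big_geq ?biased_prime_sum_ge0// ltnW.
Qed.

Lemma odd_prime_dvd_odd_prod (m p : nat) : prime p -> odd p -> (p < 2 * m)%N ->
  (p %| \prod_(k < m) (2 * k + 1))%N.
Proof.
move=> p_prime p_odd p_lt.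
have k_lt : (p./2 < m)%N by move: p_lt p_odd; clear; lia.
rewrite (bigD1 (Ordinal k_lt))//= (_ : 2 * p./2 + 1 = p)%N ?dvdn_mulr//.
by move: p_odd; clear; lia.
Qed.

(* If the sum converged, most values x^2 + D y^2 with x = 1 and y = 0 modulo all
   small primes would have no biased prime factor. The modulus Q depends on the first
   threshold m only, so the second threshold P2 may be chosen after Q in order to
   absorb the primes exceeding I^2, each of which contributes O(1) pairs. *)
Lemma biased_prime_sum_no_small_tail l : l = 3%N \/ l = 4%N ->
  ~ forall eps : rat, 0 < eps -> exists m, forall n, biased_prime_sum l m n <= eps.
Proof.
move=> hl tail.
have [p1 tail1] := tail 64%:R^-1 isT.
(* The primes that remain are at least 2 m >= 34, so their sum of 1/p^2 is at most 1/32, and those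
   that are biased have sum of 1/p at most 1/64. *)
pose m := (p1 + 17)%N; pose Q := (\prod_(k < m) (2 * k + 1))%N.
have Q_odd : odd Q.
  rewrite /Q; elim/big_ind: _ => // [x y|k _]; first by rewrite oddM => -> ->.
  by rewrite oddD oddM.
have Q3 : (3 %| Q)%N by apply: odd_prime_dvd_odd_prod => //; rewrite /m; clear; lia.
have Q_gt0 : (0 < Q)%N by case: (Q) Q_odd.
have large p : prime p -> ~~ (p %| 12 * Q)%N -> (2 * m <= p)%N.
  move=> p_prime; apply: contraNleq => p_lt.
  have [->|p_odd] := even_prime p_prime; first by rewrite dvdn_mulr.
  by rewrite dvdn_mull// odd_prime_dvd_odd_prod.
(* Since X <= 577 Q^2 I^2, this makes 4 X [eps2] at most I^2 / 16. *)
pose eps2 : rat := (64 * 577 * Q ^ 2)%:R^-1.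
have eps2_gt0 : 0 < eps2 by rewrite invr_gt0 ltr0n !(muln_gt0, expn_gt0) Q_gt0.
have [P2 tail2] := tail eps2 eps2_gt0.
have [I I_def] : exists I, I = (100 * P2.+1)%N by exists (100 * P2.+1)%N.
have [X X_def] : exists X, X = (576 * Q ^ 2 * I ^ 2 + 1)%N.
  by exists (576 * Q ^ 2 * I ^ 2 + 1)%N.
have I_gt0 : (0 < I)%N by rewrite I_def.
have X_le : (X <= 577 * Q ^ 2 * I ^ 2)%N.
  have : (0 < Q ^ 2 * I ^ 2)%N by rewrite !(muln_gt0, expn_gt0) Q_gt0 I_gt0.
  by rewrite X_def -!mulnA; move: (Q ^ 2 * I ^ 2)%N; clear; lia.
have I_le_X : (6 * I <= X)%N.
  by rewrite X_def; move: Q_gt0 I_gt0; move: (Q) (I); clear=> r n; nia.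
have P2_le : (P2 <= X)%N by apply: leq_trans I_le_X; rewrite I_def; clear; lia.
have N_lt (i j : 'I_I) : (form_val l Q i j < X)%N.
  rewrite X_def addn1 ltnS /form_val.
  have x_le : (form_x Q i <= 12 * Q * I)%N.
    rewrite /form_x; move: (ltn_ord i) Q_gt0; move: (I) (Q) (nat_of_ord i) => n r k; clear; nia.
  have y_le : (form_y Q j <= 12 * Q * I)%N.
    rewrite /form_y; move: (ltn_ord j) Q_gt0; move: (I) (Q) (nat_of_ord j) => n r k; clear; nia.
  have c_le : (form_coef l <= 3)%N by rewrite /form_coef; case: ifP.
  apply: leq_trans (_ : (12 * Q * I) ^ 2 + 3 * (12 * Q * I) ^ 2 <= _)%N.
    by apply: leq_add; last apply: leq_mul; rewrite ?leq_exp2r.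
  by rewrite leq_eqVlt; apply/orP; left; apply/eqP; ring.
have := pairs_union_bound hl Q_odd Q3 N_lt.
rewrite leqNgt => /negP; apply; rewrite -(ltr_nat rat) natr_sum.
have [i2 i2_def] : exists i2 : rat, i2 = I%:R ^+ 2 by exists (I%:R ^+ 2).
(* [F1] bounds the pairs with p dividing x and 6 j + 1, [F2] is the main term for root pairs, and
   [F3], [F4] share their constant 4: below [P2] it is kept, above it 4 <= 4 X / p. The total is at
   most 3/8 I^2 + 12 I + 4 P2, below I^2. *)
pose F1 (p : nat) : rat := if (2 * m <= p)%N && (p < 6 * I)%N then
   2%:R * i2 * (p%:R ^+ 2)^-1 + 2%:R else 0.
pose F2 (p : nat) : rat := if [&& prime p, biased_prime l p & (2 * m <= p)%N] then
   16%:R * i2 * p%:R^-1 else 0.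
pose F3 (p : nat) : rat := if (p < P2)%N then 4%:R else 0.
pose F4 (p : nat) : rat := if [&& prime p, biased_prime l p & (P2 <= p)%N] then
   4%:R * X%:R * p%:R^-1 else 0.
have i2_ge0 : 0 <= i2 by rewrite i2_def exprn_ge0 ?ler0n.
have F_ge0 p : [/\ 0 <= F1 p, 0 <= F2 p, 0 <= F3 p & 0 <= F4 p].
  have inv_ge0 : 0 <= p%:R^-1 :> rat by rewrite invr_ge0 ler0n.
  have n_ge0 n : 0 <= n%:R :> rat := ler0n _ n.
  have if_ge0 (b : bool) (x : rat) : 0 <= x -> 0 <= (if b then x else 0) by case: b.
  split; apply: if_ge0.
  - apply: addr_ge0; last exact: n_ge0.
    apply: mulr_ge0; first by apply: mulr_ge0; [exact: n_ge0 | exact: i2_ge0].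
    by rewrite invr_ge0 exprn_ge0.
  - apply: mulr_ge0; last exact: inv_ge0.
    by apply: mulr_ge0; [exact: n_ge0 | exact: i2_ge0].
  - exact: n_ge0.
  - apply: mulr_ge0; last exact: inv_ge0.
    by apply: mulr_ge0; exact: n_ge0.
have pointwise p : (p < X)%N -> prime p -> ~~ (p %| 12 * Q)%N ->
    (dividing_pairs Q I p + biased_prime l p * root_pairs l Q I p)%:R <= F1 p + F2 p + F3 p + F4 p.
  move=> p_lt p_prime p12Q; have p_ge := large p p_prime p12Q.
  rewrite natrD -!addrA; apply: lerD.
    have := dividing_pairs_le_rat I_gt0 p_prime p12Q; rewrite -i2_def /F1 p_ge /=.
    by case: ltnP; rewrite ?mul1r ?mul0r.
  have [_ F2_ge0 F3_ge0 F4_ge0] := F_ge0 p.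
  case: (boolP (biased_prime l p)) => p_good; last by rewrite mul0n !addr_ge0.
  rewrite mul1n; apply: le_trans (root_pairs_le_rat I hl Q_odd Q3 p_prime p12Q) _.
  rewrite -i2_def /F2 p_prime p_good p_ge /= lerD2l /F3 /F4 p_prime p_good /=.
  case: ltnP => _; rewrite ?addr0 ?add0r//.
  have p_gt0 : 0 < p%:R :> rat by rewrite ltr0n prime_gt0.
  by rewrite -mulrA ler_peMr// ler_pdivlMr// mul1r ler_nat ltnW.
have sumF1 : \sum_(0 <= p < X) F1 p <= i2 / 16%:R + 12%:R * I%:R.
  rewrite /F1 -big_mkcond /= -(big_nat_widen _ _ _ (fun p => (2 * m <= p)%N))//.
  rewrite -(big_nat_widenl (2 * m) 0 _ xpredT)//= big_split /= -mulr_sumr.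
  apply: lerD.
    have [le6|lt6] := leqP (6 * I) (2 * m).
      by rewrite big_geq// mulr0 divr_ge0 ?exprn_ge0 ?ler0n.
    rewrite -(subnKC (ltnW lt6)).
    set S := \sum_(_ <= p < _) _.
    have S_le : S <= 32%:R^-1.
      apply: le_trans (sum_inv_sq_le _ _) _; first by rewrite /m; clear; lia.
      apply: le_trans (_ : ((2 * m).-1)%:R^-1 <= _).
        by rewrite lerBlDr lerDl invr_ge0 ler0n.
      by rewrite lef_pV2 ?posrE ?ltr0n ?ler_nat// /m; clear; lia.
    have i2_ge0' : 0 <= 2%:R * i2 by rewrite mulr_ge0 ?ler0n.
    apply: le_trans (ler_wpM2l i2_ge0' S_le) _.
    by rewrite le_eqVlt; apply/orP; left; apply/eqP; field.
  rewrite sumr_const_nat -[leLHS]mulr_natr -!natrM ler_nat.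
  by clear; lia.
have sumF2 : \sum_(0 <= p < X) F2 p <= i2 / 4%:R.
  rewrite /F2 -big_mkcond /= -mulr_sumr -biased_prime_sumE.
  have le1 : biased_prime_sum l (2 * m) X <= 64%:R^-1.
    by apply: le_trans (tail1 X); apply: biased_prime_sum_le; rewrite /m; clear; lia.
  apply: le_trans (ler_wpM2l _ le1) _; first by rewrite mulr_ge0 ?ler0n.
  by rewrite le_eqVlt; apply/orP; left; apply/eqP; field.
have sumF3 : \sum_(0 <= p < X) F3 p <= 4%:R * P2%:R.
  rewrite /F3 -big_mkcond /= -(big_nat_widen _ _ _ xpredT)//.
  by rewrite sumr_const_nat subn0 mulr_natr.
have sumF4 : \sum_(0 <= p < X) F4 p <= i2 / 16%:R.
  rewrite /F4 -big_mkcond /= -mulr_sumr -biased_prime_sumE.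
  apply: le_trans (ler_wpM2l _ (tail2 X)) _; first by rewrite mulr_ge0 ?ler0n.
  rewrite /eps2 ler_pdivrMr ?ltr0n ?(muln_gt0, expn_gt0) ?Q_gt0//.
  rewrite i2_def [leRHS](_ : _ = (4 * (577 * Q ^ 2 * I ^ 2))%:R).
    by rewrite -natrM ler_nat leq_mul2l X_le.
  by rewrite !(natrM, natrX); field.
apply: le_lt_trans (_ : \sum_(0 <= p < X) (F1 p + F2 p + F3 p + F4 p) < _).
  rewrite big_mkcond /= big_nat_cond [leRHS]big_nat_cond.
  apply: ler_sum => p; rewrite andbT => /andP[_ p_lt].
  have [? ? ? ?] := F_ge0 p.
  case: (boolP (prime p && _)) => [/andP[p_prime p12Q]|_]; last by rewrite !addr_ge0.
  exact: pointwise.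
rewrite !big_split /=.
apply: le_lt_trans (lerD (lerD (lerD sumF1 sumF2) sumF3) sumF4) _.
have IE : I%:R = 100%:R * P2%:R + 100%:R :> rat by rewrite I_def natrM -[P2.+1%:R]natr1 mulrDr mulr1.
rewrite natrM i2_def IE; have : 0 <= P2%:R :> rat by rewrite ler0n.
by move: (P2%:R : rat); clear => x x_ge0; nra.
Qed.

(** If the partial sums were bounded, the tails would become small: otherwise blocks of sum more
    than eps could be appended without end. *)
Lemma biased_primes_diverge l (p0 : nat) (C : rat) : l = 3%N \/ l = 4%N ->
  exists n, C <= biased_prime_sum l p0 n.
Proof.
move=> hl; apply: contrapT => bounded.
have bound n : biased_prime_sum l p0 n < C.
  by rewrite ltNge; apply/negP => h; apply: bounded; exists n.
apply: (biased_prime_sum_no_small_tail hl) => eps eps_gt0; apply: contrapT => no_tail.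
have step m : exists n, (m <= n)%N /\ eps < biased_prime_sum l m n.
  apply: contrapT => none; apply: no_tail; exists m => n.
  rewrite leNgt; apply/negP => h; apply: none; exists n; split=> //.
  rewrite leqNgt; apply/negP => nm; move: h.
  by rewrite /biased_prime_sum big_geq ?(ltnW nm)// ltNge ltW.
have iter k : exists n, (p0 <= n)%N /\ k%:R * eps <= biased_prime_sum l p0 n.
  elim: k => [|k [n [p0n IH]]]; first by exists p0; rewrite mul0r biased_prime_sum_ge0.
  have [n' [nn' h]] := step n; exists n'; split; first exact: leq_trans nn'.
  by rewrite (biased_prime_sum_cat _ p0n nn') -natr1 mulrDl mul1r lerD// ltW.
have [n [_ h]] := iter (Num.bound `|C / eps|).
have := le_lt_trans h (bound n); apply/negP; rewrite -leNgt.
rewrite -ler_pdivrMr// ltW//; apply: le_lt_trans (ler_norm _) _.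
by rewrite archi_boundP.
Qed.

(** * Progressions in which sums of l powers are rare *)

Local Open Scope ring_scope.

Lemma geometric_sum_le (x : rat) (K : nat) : 0 <= x -> x < 1 ->
  \sum_(k < K) x ^+ k <= (1 - x)^-1.
Proof.
move=> x0 x1; rewrite -[leRHS]mul1r ler_pdivlMr ?subr_gt0// mulrC.
by rewrite -opprB mulNr -subrX1 opprB lerBlDr lerDl exprn_ge0.
Qed.

(** The greedy choice runs with weights (3/4)^k, whose sum is at most 4 for every K; hence the
    primes it needs, and [P], depend on eta only. When it stops, the density at shift k is below
    eta' (4/3)^k, and against the weights 2^-k this sums to at most 3 eta' = eta. *)
Lemma sparse_progression (l : nat) (eta : rat) : l = 3%N \/ l = 4%N -> 0 < eta ->
  exists2 P, (0 < P)%N & forall K, exists M n, [/\ (0 < M)%N, (M %| P)%N &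
    \sum_(k < K) (2%:R ^+ k)^-1 * density l M (n + k) <= eta].
Proof.
move=> hl eta_gt0; pose eta' := eta / 3%:R.
have eta'_gt0 : 0 < eta' by rewrite divr_gt0.
pose E := (Num.bound (8%:R / eta')).+1.
have E_large : 2%:R * 4%:R <= eta' * E%:R.
  rewrite -natrM mulrC -ler_pdivrMr// ltW//.
  apply: lt_trans (_ : (Num.bound (8%:R / eta'))%:R < _); last by rewrite ltr_nat.
  by apply: archi_boundP; rewrite divr_ge0// ltW.
have [p0 bias] := local_bias_density hl (ltn0Sn _ : (0 < E)%N).
(* Half of eta' times 10 / eta' is 5, more than the initial potential 4. *)
have [n0 sum_large] := biased_primes_diverge p0 (10%:R / eta') hl.
pose ps := [seq p <- index_iota p0 n0 | prime p && biased_prime l p].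
have ps_prime : all prime ps.
  by apply/allP => p; rewrite mem_filter => /andP[/andP[]].
exists (\prod_(p <- ps) p)%N.
  by rewrite big_seq prodn_cond_gt0// => p /(allP ps_prime); apply: prime_gt0.
move=> K; pose rho : rat := 3%:R / 4%:R.
have rho_gt0 : 0 < rho by [].
have rho_sum : \sum_(k < K) rho ^+ k <= 4%:R by apply: geometric_sum_le.
have ps_uniq : uniq ps by rewrite filter_uniq// iota_uniq.
have ps_bias p : p \in ps -> exists R, biased l E p R.
  rewrite mem_filter mem_index_iota => /andP[/andP[p_prime p_good] /andP[p_ge _]].
  exact: bias.
have [[M [n [M_gt0 M_dvd small]]]|[n n_le]] :=
  greedy rho_gt0 eta'_gt0 rho_sum (ltn0Sn _) E_large ps_uniq ps_prime ps_bias.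
  exists M, n; split=> //.
  apply: le_trans (_ : eta' * \sum_(k < K) (2%:R / 3%:R) ^+ k <= _).
    rewrite mulr_sumr; apply: ler_sum => k _.
    have -> : (2%:R ^+ k)^-1 = (2%:R / 3%:R) ^+ k * rho ^+ k :> rat.
      by rewrite -exprMn -exprVn.
    rewrite -mulrA mulrC ler_wpM2r ?exprn_ge0 ?divr_ge0//.
    by rewrite ltW// small.
  have sum_le : \sum_(k < K) (2%:R / 3%:R) ^+ k <= 3%:R :> rat.
    by apply: geometric_sum_le.
  by apply: le_trans (ler_wpM2l (ltW eta'_gt0) sum_le) _; rewrite /eta' divfK.
exfalso; move: n_le; apply/negP; rewrite -ltNge.
have Phi_ge0 : 0 <= \sum_(k < K) rho ^+ k * density l (\prod_(p <- ps) p) (n + k).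
  by apply: sumr_ge0 => k _; rewrite mulr_ge0 ?density_ge0// exprn_ge0// ltW.
apply: lt_le_trans Phi_ge0; rewrite subr_lt0.
apply: lt_le_trans (_ : eta' / 2%:R * (10%:R / eta') <= _).
  by rewrite (_ : _ * _ = 5%:R)//; field; rewrite gt_eqF.
apply: ler_wpM2l; first by rewrite divr_ge0 ?(ltW eta'_gt0).
by rewrite /ps big_filter.
Qed.

(** * Representations as sums of powers *)

Local Open Scope nat_scope.

(** Ordered representations, 0 allowed, with all variables below Y. For n < Y^l and l > 0 none is
    lost. *)
Definition nreps (l Y j n : nat) : nat :=
  #|[pred x : {ffun 'I_j -> 'I_Y} | \sum_i x i ^ l == n]|.

Section Representations.
Variables (l Y : nat).
Hypothesis l_gt0 : 0 < l.

Lemma nreps_gt0P j n : reflect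
  (exists x : {ffun 'I_j -> 'I_Y}, \sum_i x i ^ l = n) (0 < nreps l Y j n).
Proof.
apply: (iffP card_gt0P) => [[x]|[x xn]]; first by rewrite inE => /eqP; exists x.
by exists x; rewrite inE; apply/eqP.
Qed.

Lemma nreps_addX j s v : v < Y -> 0 < nreps l Y j s -> 0 < nreps l Y j.+1 (s + v ^ l).
Proof.
move=> v_lt /nreps_gt0P[x <-]; apply/nreps_gt0P.
exists [ffun i => if unlift ord0 i is Some i' then x i' else Ordinal v_lt].
rewrite big_ord_recl ffunE unlift_none addnC; congr (_ + _).
by apply: eq_bigr => i _; rewrite ffunE liftK.
Qed.

Lemma nreps_le j j' n : 0 < Y -> j <= j' -> 0 < nreps l Y j n -> 0 < nreps l Y j' n.
Proof.
move=> Y_gt0 /subnKC <- rep_n; elim: (j' - j) => [|k IH]; first by rewrite addn0.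
by have := nreps_addX Y_gt0 IH; rewrite exp0n// addn0 addnS.
Qed.

Lemma nreps0_gt0 j : 0 < Y -> 0 < nreps l Y j 0.
Proof.
move=> Y_gt0; apply: (@nreps_le 0) => //; apply/nreps_gt0P.
by exists [ffun=> Ordinal Y_gt0]; rewrite big_ord0.
Qed.

Lemma sum_nreps_le j X : \sum_(s < X) nreps l Y j s <= Y ^ j.
Proof.
apply: (@leq_trans #|{: {ffun 'I_j -> 'I_Y}}|); last by rewrite card_ffun !card_ord.
rewrite -[leqRHS]sum1_card.
under [leqLHS]eq_bigr => s _ do rewrite /nreps -sum1_card big_mkcond.
rewrite exchange_big /=; apply: leq_sum => x _.
rewrite -big_mkcond /= sum1dep_card.
case: (pickP [pred s : 'I_X | \sum_i x i ^ l == s]) => [s /= /eqP xs|none].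
  rewrite (eq_card (B := pred1 s)) ?card1// => s'; rewrite !inE xs eq_sym.
  by rewrite -val_eqE.
rewrite eq_card0// => s; rewrite !inE; exact: none.
Qed.

End Representations.

(** Since Y = M t, every residue modulo M has exactly t lifts below Y; each tuple is counted for at
    most one N. *)
Lemma sum_nreps_progression_le (l M t n i X : nat) : 0 < M ->
  \sum_(N < X | (N.+1 == n %[mod M]) && (N + i.+1 < X)) nreps l (M * t) l (N + i.+1)
    <= t ^ l * nsol_mod l M (n + i).
Proof.
move=> M_gt0.
apply: (@leq_trans #|[pred x : {ffun 'I_l -> 'I_(M * t)} |
    \sum_i x i ^ l == n + i %[mod M]]|).
  rewrite -[leqRHS]sum1_card [leqRHS]big_mkcond /=.
  under [leqLHS]eq_bigr => N _ do rewrite /nreps -sum1_card big_mkcond.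
  rewrite exchange_big /=; apply: leq_sum => x _.
  rewrite -big_mkcondr /= sum1dep_card inE.
  case: (boolP (_ == _ %[mod M])) => [_|none].
    case: (pickP [pred N : 'I_X | \sum_i x i ^ l == N + i.+1]) => [N /= /eqP xN|none].
      apply: leq_trans (_ : #|pred1 N| <= 1); last by rewrite card1.
      apply: subset_leq_card; apply/subsetP => N'; rewrite !inE xN.
      by rewrite eqn_add2r => /andP[_ /eqP NN']; apply/eqP/val_inj.
    rewrite eq_card0// => N; rewrite !inE; have := none N => /= ->.
    by rewrite andbF.
  rewrite leqn0 cards_eq0 -subset0; apply/subsetP => N; rewrite !inE.
  move=> /andP[/andP[/eqP Nn _] /eqP xN]; move: none; rewrite xN addnS -addSn.
  by rewrite -modnDml Nn modnDml eqxx.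
have div_lt (x : 'I_(M * t)) : x %/ M < t by rewrite ltn_divLR// [t * M]mulnC.
pose f (x : {ffun 'I_l -> 'I_(M * t)}) : {ffun 'I_l -> 'I_t} * {ffun 'I_l -> 'I_M} :=
  ([ffun i => Ordinal (div_lt (x i))], [ffun i => Ordinal (ltn_pmod (x i) M_gt0)]).
have f_inj : injective f.
  move=> x x' [/ffunP fd /ffunP fm]; apply/ffunP => k; apply: val_inj => /=.
  have := fd k; have := fm k; rewrite !ffunE => -[hm] [hd].
  by rewrite (divn_eq (x k) M) (divn_eq (x' k) M) hm hd.
rewrite -(card_imset _ f_inj).
have -> : t ^ l = #|{ffun 'I_l -> 'I_t}| by rewrite card_ffun !card_ord.
rewrite /nsol_mod -cardX; apply: subset_leq_card.
apply/subsetP => _ /imsetP[x xn ->]; move: xn; rewrite !inE /= => /eqP <-.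
apply/eqP; apply: modn_sum_pow => k; by rewrite ffunE /= modn_mod.
Qed.

(** * Gaps between sums of l - 1 powers *)

Local Open Scope nat_scope.

Lemma progression_block (M n s : nat) : 0 < M ->
  exists2 N, s <= N < s + M & N.+1 = n %[mod M].
Proof.
move=> M_gt0; exists (s + (n + M.-1 * s.+1) %% M).
  by rewrite leq_addr ltn_add2l ltn_pmod.
rewrite -addSn modnDmr addnCA -mulSn prednK//.
by rewrite -modnDmr modnMr addn0.
Qed.

Lemma progression_count (M n s v : nat) : 0 < M ->
  v <= M * (\sum_(s <= N < s + v) (N.+1 == n %[mod M])).+1.
Proof.
move=> M_gt0; pose c u := \sum_(s <= N < s + u) (N.+1 == n %[mod M]).
have blocks k : k <= c (k * M).
  elim: k => // k IH; have [N /andP[sN NM] Nn] := progression_block n (s + k * M) M_gt0.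
  rewrite /c mulSn (addnC M) addnA (@big_cat_nat _ _ _ (s + k * M)) ?leq_addr//=.
  rewrite -addn1 leq_add//.
  rewrite (@big_cat_nat _ _ _ N) ?(ltnW NM)//= [X in _ <= _ + X]big_ltn// Nn eqxx.
  by rewrite addnC -addnA leq_addr.
have c_mono : c (v %/ M * M) <= c v.
  rewrite /c [leqRHS](@big_cat_nat _ _ _ (s + v %/ M * M)) ?leq_addr//=.
  by rewrite leq_add2l leq_trunc_div.
rewrite [leqLHS](divn_eq v M) mulnS addnC leq_add ?(ltnW (ltn_pmod _ _))//.
by rewrite mulnC leq_mul2l (leq_trans (blocks _) c_mono) orbT.
Qed.

Section Gaps.
Variables (l Y D : nat).
Hypotheses (l_gt0 : 0 < l) (Y_gt0 : 0 < Y).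
Let X := Y ^ l.

(* At such N the sums of fewer than l powers do not enter tail N up to the index
   m + D, while the sum m of l powers does, which forces tail N >= 1. *)
Definition dominated (N : nat) : bool :=
  [exists m : 'I_X, [&& N < m, 0 < nreps l Y l m, m + D < X &
     [forall s : 'I_X, (N < s <= m + D) ==> (nreps l Y l.-1 s == 0)]]].

Variables (M n : nat).
Hypothesis M_gt0 : 0 < M.

Definition dominated_count (u : nat) : nat :=
  \sum_(0 <= N < u) (dominated N && (N.+1 == n %[mod M])).

Let c u := \sum_(0 <= s < u) (0 < nreps l Y l.-1 s).

(** Take the largest suitable power of 2 for x; doubling it multiplies x^l by 2^l. *)
Let power_between g : 2 <= g -> exists x, 2 * x ^ l <= g < 2 ^ l.+1 * x ^ l.
Proof.
move=> g_ge2; have ex : exists e, 2 * (2 ^ e) ^ l <= g by exists 0; rewrite exp1n.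
have bound e : 2 * (2 ^ e) ^ l <= g -> e <= g.
  move=> h; apply: leq_trans (ltnW (ltn_expl e (ltnSn 1))) _.
  apply: leq_trans h; apply: leq_trans (leq_pmull _ (ltn0Sn 1)).
  by rewrite -{1}[2 ^ e]expn1 leq_pexp2l// expn_gt0.
case: (ex_maxnP ex bound) => e e_le e_max; exists (2 ^ e); rewrite e_le /=.
have E : 2 * (2 ^ e.+1) ^ l = 2 ^ l.+1 * (2 ^ e) ^ l.
  by rewrite [2 ^ e.+1]expnS expnMn mulnA -expnS.
by rewrite ltnNge -E; apply/negP => /e_max; rewrite ltnn.
Qed.

Let good_in_gap s u x N : 0 < nreps l Y l.-1 s -> u <= X ->
  (forall r, s < r < u -> nreps l Y l.-1 r = 0) -> 2 * x ^ l <= u - s ->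
  2 * D.+1 < u - s -> s <= N < s + x ^ l -> dominated N.
Proof.
move=> s_rep u_le gap x_le D_lt /andP[sN Nx].
have m_lt : s + x ^ l + D < u by lia.
have m_ltX : s + x ^ l < X by lia.
have x_lt : x < Y.
  rewrite ltnNge; apply/negP => Yx; have : X <= x ^ l by rewrite leq_exp2r.
  by lia.
apply/existsP; exists (Ordinal m_ltX) => /=; rewrite Nx /= -{1}[l in X in nreps _ _ X](prednK l_gt0).
rewrite nreps_addX//= (leq_trans m_lt)//=; apply/forallP => r; apply/implyP.
by move=> /andP[Nr rm]; apply/eqP/gap; lia.
Qed.

(** Induction along the gaps [s, u). A gap of length at most 2 (D + 1) is paid for by one unit of
    [c]; a longer one contains at least a fraction 2^-(l+1) of dominated N, of which one in M lies
    in the progression up to a bounded error. The case u = X is the last, possibly incomplete,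
    gap. *)
Lemma gap_count u : u <= X -> (u == X) || (0 < nreps l Y l.-1 u) ->
  u <= 2 ^ l.+1 * M * (dominated_count u + D.+1 * c u).
Proof.
elim/ltn_ind: u => u IH u_le u_rep.
case: (posnP u) => [->//|u_gt0].
have ex : exists s, (s < u) && (0 < nreps l Y l.-1 s) by exists 0; rewrite u_gt0 nreps0_gt0.
have bound s : (s < u) && (0 < nreps l Y l.-1 s) -> s <= u by move=> /andP[/ltnW].
case: (ex_maxnP ex bound) => s /andP[s_lt s_rep] s_max.
have gap r : s < r < u -> nreps l Y l.-1 r = 0.
  move=> /andP[sr ru]; apply/eqP; rewrite -leqn0 leqNgt; apply/negP => r_rep.
  by have := s_max r; rewrite ru r_rep => /(_ isT); rewrite leqNgt sr.
have {IH} IHs := IH s s_lt (leq_trans (ltnW s_lt) u_le).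
rewrite s_rep orbT in IHs; have {}IHs := IHs isT.
have cu : (c s).+1 <= c u.
  rewrite /c [leqRHS](@big_cat_nat _ _ _ s) ?(ltnW s_lt)//= [X in _ <= _ + X]big_ltn//.
  by rewrite s_rep -addn1 leq_add2l leq_addr.
have Gu v : s + v <= u -> dominated_count s + \sum_(s <= N < s + v)
    (dominated N && (N.+1 == n %[mod M])) <= dominated_count u.
  move=> sv; rewrite /dominated_count [leqRHS](@big_cat_nat _ _ _ s) ?(ltnW s_lt)//=.
  by rewrite leq_add2l [leqRHS](@big_cat_nat _ _ _ (s + v)) ?leq_addr.
have [small|large] := leqP (u - s) (2 * D.+1).
  have := Gu 0; rewrite addn0 big_geq// addn0 => /(_ (ltnW s_lt)) {Gu} Gu.
  rewrite -[leqLHS](subnKC (ltnW s_lt)); apply: leq_trans (leq_add IHs small) _.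
  apply: leq_trans (_ : 2 ^ l.+1 * M * (dominated_count s + D.+1 * c s + D.+1) <= _).
    rewrite [leqRHS]mulnDr leq_add2l leq_mul// expnS -mulnA leq_pmulr//.
    by rewrite muln_gt0 expn_gt0.
  rewrite leq_mul2l -addnA -mulnSr; apply/orP; right; apply: leq_add => //.
  by rewrite leq_mul2l cu orbT.
have [|x /andP[x_le x_ge]] := @power_between (u - s).
  by apply: leq_trans (ltnW large); rewrite mulnS leq_addr.
have Gx : dominated_count s + \sum_(s <= N < s + x ^ l) (N.+1 == n %[mod M]) <= dominated_count u.
  apply: leq_trans (Gu (x ^ l) _); last by move: x_le s_lt; clear; lia.
  rewrite leq_add2l big_nat_cond [leqRHS]big_nat_cond; apply: leq_sum => N.
  rewrite andbT => sN; rewrite (good_in_gap s_rep u_le gap x_le large sN).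
  by [].
have := progression_count n s (x ^ l) M_gt0; set k := \sum_(_ <= _ < _) _ in Gx *.
move=> k_ge; rewrite -[leqLHS](subnKC (ltnW s_lt)).
apply: leq_trans (leq_add IHs (ltnW x_ge)) _.
apply: leq_trans (_ : 2 ^ l.+1 * M * (dominated_count s + k + D.+1 * (c s).+1) <= _).
  apply: leq_trans (_ : 2 ^ l.+1 * M * (dominated_count s + D.+1 * c s) +
      2 ^ l.+1 * (M * k.+1) <= _); first by rewrite leq_add2l leq_mul2l k_ge orbT.
  rewrite mulnA -mulnDr leq_mul2l; apply/orP; right.
  by move: (dominated_count s) (c s); clear; nia.
rewrite leq_mul2l; apply/orP; right; apply: leq_add => //.
by rewrite leq_mul2l cu orbT.
Qed.

Lemma dominated_count_ge :
  X <= 2 ^ l.+1 * M * (dominated_count X + D.+1 * Y ^ l.-1).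
Proof.
have := gap_count (leqnn X); rewrite eqxx => /(_ isT) h; apply: leq_trans h _.
rewrite leq_mul2l leq_add2l leq_mul2l; apply/orP; right; apply/orP; right.
apply: leq_trans (sum_nreps_le l Y l.-1 X); rewrite /c big_mkord.
by apply: leq_sum => s _; case: (nreps _ _ _ _).
Qed.

End Gaps.

(** * Integrality of the tails against sparse progressions *)

Local Open Scope ring_scope.

Section Tails.
Variables (l Y q : nat) (a : nat -> int) (D W : nat).
Hypotheses (l_gt0 : (0 < l)%N) (Y_gt0 : (0 < Y)%N) (q_ge2 : (2 <= q)%N).
Hypothesis al_gt0 : 0 < a l.
Let X := (Y ^ l)%N.

Definition tail_coef (n : nat) : int := \sum_(j < l.+1) a j * (nreps l Y j n)%:Z.

(** The T(N) of the overview when N < Y^l and the relation holds: the whole series vanishes, so its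
    tail is minus its initial part, which is visibly an integer after multiplication by q^N. *)
Definition tail (N : nat) : int :=
  - \sum_(m < N.+1) tail_coef m * (q ^ (N - m))%N%:Z.

Hypothesis tail_le : forall N, (N < X)%N -> `|tail N| <= W%:Z.
Hypothesis D_large : (W < q ^ D)%N.

Lemma tailS N : tail N.+1 = q%:Z * tail N - tail_coef N.+1.
Proof.
rewrite /tail big_ord_recr /= subnn expn0 mulr1 opprD; congr (_ - _).
rewrite mulrN mulr_sumr; congr (- _); apply: eq_bigr => m _.
have mN : (m <= N)%N by rewrite -ltnS.
by rewrite (subSn mN) expnS PoszM mulrCA.
Qed.

Let q_gt0 : 0 < q%:R :> rat.
Proof. by rewrite ltr0n ltnW. Qed.

Lemma tailE N k : (tail N)%:~R = \sum_(i < k) (tail_coef (N + i.+1))%:~R / q%:R ^+ i.+1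
   + (tail (N + k))%:~R / q%:R ^+ k :> rat.
Proof.
elim: k => [|k ->]; first by rewrite big_ord0 add0r addn0 expr0 divr1.
rewrite big_ord_recr -addrA; congr (_ + _) => /=.
rewrite addnS tailS rmorphB rmorphM /= -mulrDl addrC subrK exprS.
by rewrite -pmulrn -mulf_div divff ?mul1r ?gt_eqF.
Qed.

(** Up to m + D only a_l r_l contributes, with at least q^-(m-N) at m, and the remainder is smaller
    than that because |tail| <= W < q^D. So the integer [tail N] is positive, hence at least 1; as
    the remainder is below 1/2, the sum keeps at least 1/2. Replacing q by 2 only increases it. *)
Lemma dominated_weight N : dominated l Y D N ->
  1 <= 2%:R * (a l)%:~R * \sum_(i < X | (N + i.+1 < X)%N)
     (nreps l Y l (N + i.+1))%:R / 2%:R ^+ i.+1 :> rat.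
Proof.
move=> /existsP[m /and4P[Nm m_rep mD /forallP gap]].
pose k := (m + D - N)%N.
have NkE : (N + k = m + D)%N by rewrite /k; lia.
have coefE i : (i < k)%N -> tail_coef (N + i.+1) = a l * (nreps l Y l (N + i.+1))%:Z.
  move=> ik; have s_lt : (N + i.+1 < X)%N by rewrite /X; lia.
  have := gap (Ordinal s_lt); rewrite /= (_ : (N < N + i.+1 <= m + D)%N); last by lia.
  rewrite implyTb => /eqP rep0.
  rewrite /tail_coef big_ord_recr /= big1 ?add0r// => j _.
  have -> : nreps l Y j (N + i.+1) = 0%N; last by rewrite mulr0.
  apply/eqP; rewrite -leqn0 leqNgt; apply/negP => rep_j.
  have j_le : (j <= l.-1)%N by rewrite -ltnS prednK.
  by have := nreps_le l_gt0 Y_gt0 j_le rep_j; rewrite rep0.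
have al_r : 1 <= (a l)%:~R :> rat by rewrite -[1]/(1%:~R) ler_int.
pose w i : rat := (nreps l Y l (N + i.+1))%:R / q%:R ^+ i.+1.
have w_ge0 i : 0 <= w i by rewrite divr_ge0 ?exprn_ge0 ?ler0n.
have tE : (tail N)%:~R = (a l)%:~R * (\sum_(i < k) w i) + (tail (N + k))%:~R / q%:R ^+ k :> rat.
  rewrite (tailE N k); congr (_ + _); rewrite mulr_sumr; apply: eq_bigr => i _.
  by rewrite coefE// rmorphM /= -mulrA.
have i0_lt : (m - N.+1 < k)%N by rewrite /k; lia.
have w_i0 : (q%:R ^+ (m - N))^-1 <= \sum_(i < k) w i.
  rewrite (bigD1 (Ordinal i0_lt))//=; apply: le_trans (_ : w (m - N.+1)%N <= _).
    rewrite /w (_ : (N + (m - N.+1).+1 = m)%N); last by lia.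
    rewrite (_ : ((m - N.+1).+1 = m - N)%N); last by lia.
    by rewrite ler_peMl ?invr_ge0 ?exprn_ge0 ?ler0n// -[1]/(1%:R) ler_nat.
  by rewrite lerDl sumr_ge0.
have t_le : `|(tail (N + k))%:~R / q%:R ^+ k| < (q%:R ^+ (m - N))^-1 :> rat.
  rewrite normrM normfV (ger0_norm (exprn_ge0 _ _)) ?ler0n//.
  rewrite ltr_pdivrMr ?exprn_gt0// (_ : k = (m - N + D)%N); last by rewrite /k; lia.
  rewrite exprD mulKf ?gt_eqF ?exprn_gt0//.
  apply: le_lt_trans (_ : W%:R < _); last by rewrite -natrX ltr_nat.
  rewrite -intr_norm (_ : W%:R = W%:Z%:~R)// ler_int (_ : (_ + _ = N + k)%N) ?tail_le//.
    by rewrite NkE.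
  by rewrite /k; lia.
have r_half : `|(tail (N + k))%:~R / q%:R ^+ k| < 2%:R^-1 :> rat.
  apply: lt_le_trans t_le _; rewrite lef_pV2 ?posrE ?exprn_gt0//.
  rewrite -natrX ler_nat; apply: leq_trans q_ge2 _.
  by rewrite -[leqLHS]expn1 leq_pexp2l ?subn_gt0// ltnW.
have tail_ge1 : 1 <= (tail N)%:~R :> rat.
  rewrite -[1]/(1%:~R) ler_int -gtz0_ge1 -(ltr_int rat) tE.
  move: t_le; rewrite ltr_norml => /andP[t_gt _].
  apply: le_lt_trans (_ : - (q%:R ^+ (m - N))^-1 + (q%:R ^+ (m - N))^-1 < _).
    by rewrite addNr.
  rewrite addrC ler_ltD//; apply: le_trans w_i0 _.
  by rewrite ler_peMl// sumr_ge0.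
have {tail_ge1} sum_ge : 1 <= 2%:R * (a l)%:~R * \sum_(i < k) w i.
  move: r_half tail_ge1; rewrite tE ltr_norml => /andP[_ r_lt] t_ge.
  rewrite -mulrA -ler_pdivrMl// mulr1; move: (_ * _) (_ / _) r_lt t_ge.
  by move=> x r; lra.
apply: le_trans sum_ge _; apply: ler_wpM2l.
  by rewrite mulr_ge0// (le_trans _ al_r).
have kX : (k <= X)%N by move: NkE mD; rewrite /X; clear; lia.
rewrite (big_ord_widen _ w kX) big_mkcond [leRHS]big_mkcond /=.
apply: ler_sum => i _; case: ifP => [ik|_]; last first.
  by case: ifP => // _; rewrite divr_ge0 ?exprn_ge0 ?ler0n.
rewrite (_ : (N + i.+1 < X)%N); last by move: NkE mD ik; rewrite /X; clear; lia.
rewrite /w ler_wpM2l ?ler0n// lef_pV2 ?posrE ?exprn_gt0//.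
by rewrite lerXn2r ?nnegrE ?ler0n ?ler_nat.
Qed.
End Tails.

Local Open Scope ring_scope.

Lemma linear_le_exp2 (c : nat) : exists u, (c * u.+1 <= 2 ^ u)%N.
Proof.
exists (4 * c)%N; have h := ltn_expl (2 * c) (ltnSn 1).
rewrite (_ : 4 * c = 2 * c + 2 * c)%N; last by rewrite -mulnDl.
rewrite expnD; move: (2 ^ (2 * c))%N h; clear => y h; nia.
Qed.

(** Summing [dominated_weight] over the progression and exchanging sums leaves, for each shift, a
    density modulo M. *)
Lemma dominated_count_le (l q : nat) (a : nat -> int) (M t D W n : nat) (eta : rat) :
  (0 < l)%N -> (0 < M)%N -> (0 < t)%N -> (2 <= q)%N -> 0 < a l ->
  (forall N, (N < (M * t) ^ l)%N -> `|tail l (M * t) q a N| <= W%:Z) ->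
  (W < q ^ D)%N ->
  \sum_(k < (M * t) ^ l) (2%:R ^+ k)^-1 * density l M (n + k) <= eta ->
  (dominated_count l (M * t) D M n ((M * t) ^ l))%:R <=
    (a l)%:~R * (t ^ l * M ^ l.-1)%:R * eta :> rat.
Proof.
move=> l_gt0 M_gt0 t_gt0 q_ge2 al_gt0 tail_le D_large sparse.
have Y_gt0 : (0 < M * t)%N by rewrite muln_gt0 M_gt0.
set Y := (M * t)%N in tail_le sparse Y_gt0 *; set X := (Y ^ l)%N in tail_le sparse *.
have al_r : 0 <= (a l)%:~R :> rat by rewrite ler0z ltW.
pose h N i : rat := (nreps l Y l (N + i.+1))%:R / 2%:R ^+ i.+1.
have h_ge0 N i : 0 <= h N i by rewrite divr_ge0 ?exprn_ge0 ?ler0n.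
apply: le_trans (_ : \sum_(N < X | N.+1 == n %[mod M])
    2%:R * (a l)%:~R * \sum_(i < X | (N + i.+1 < X)%N) h N i <= _).
  rewrite /dominated_count big_mkord natr_sum [leRHS]big_mkcond.
  apply: ler_sum => N _; case: (_ == _ %[mod M]); last by rewrite andbF.
  rewrite andbT; case: (boolP (dominated _ _ _ _)) => [good|_] /=.
    exact: dominated_weight l_gt0 Y_gt0 q_ge2 al_gt0 tail_le D_large _ good.
  by rewrite !mulr_ge0// sumr_ge0.
rewrite -mulr_sumr.
have -> : \sum_(N < X | N.+1 == n %[mod M]) \sum_(i < X | (N + i.+1 < X)%N) h N i =
  \sum_(i < X) \sum_(N < X | (N.+1 == n %[mod M]) && (N + i.+1 < X)%N) h N i.
  by rewrite (exchange_big_dep xpredT).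
apply: le_trans (_ : 2%:R * (a l)%:~R * \sum_(i < X)
   (t ^ l * nsol_mod l M (n + i))%:R / 2%:R ^+ i.+1 <= _).
  apply: ler_wpM2l; first by rewrite mulr_ge0.
  apply: ler_sum => i _; rewrite /h -mulr_suml ler_wpM2r ?invr_ge0 ?exprn_ge0//.
  by rewrite -natr_sum ler_nat sum_nreps_progression_le.
have -> : 2%:R * (a l)%:~R * \sum_(i < X) (t ^ l * nsol_mod l M (n + i))%:R / 2%:R ^+ i.+1
   = (a l)%:~R * (t ^ l * M ^ l.-1)%:R *
     \sum_(k < X) (2%:R ^+ k)^-1 * density l M (n + k) :> rat.
  rewrite !mulr_sumr; apply: eq_bigr => k _.
  rewrite /density subn1 exprS !natrM.
  have M_neq0 : (M ^ l.-1)%:R != 0 :> rat by rewrite pnatr_eq0 -lt0n expn_gt0 M_gt0.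
  have pow_neq0 : 2%:R ^+ k != 0 :> rat by rewrite expf_neq0.
  by move: (2%:R ^+ k) pow_neq0 => x x0; field; rewrite ?x0 ?M_neq0.
by rewrite ler_wpM2l// mulr_ge0.
Qed.

Lemma tail_unbounded (l q : nat) (a : nat -> int) (C : nat) :
  l = 3%N \/ l = 4%N -> (2 <= q)%N -> 0 < a l ->
  ~ (forall Y N, (0 < Y)%N -> (N < Y ^ l)%N -> `|tail l Y q a N| <= (C * Y ^ l)%N%:Z).
Proof.
move=> hl q_ge2 al_gt0 tail_le.
have l_gt0 : (0 < l)%N by case: hl => ->.
have al_r : 0 < (a l)%:~R :> rat by rewrite ltr0z.
(* With this value the first term of [dominated_count_ge] is at most Y^l / 4; the second will be at
   most Y^l / 2. *)
pose eta : rat := (2%:R ^+ l.+3 * (a l)%:~R)^-1.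
have eta_gt0 : 0 < eta by rewrite invr_gt0 mulr_gt0 ?exprn_gt0.
have [P P_gt0 sparse] := sparse_progression hl eta_gt0.
pose c0 := (C * P ^ l)%N.
(* Y = P 2^u is a multiple of every M that can occur, and D = c0 + l u gives q^D >= 2^D > c0 2^(l u)
   = C Y^l while staying logarithmic in Y. *)
have [u u_large] := linear_le_exp2 (2 ^ l.+2 * (c0 + l).+1).
pose Y := (P * 2 ^ u)%N; pose D := (c0 + l * u)%N.
have Y_gt0 : (0 < Y)%N by rewrite muln_gt0 P_gt0 expn_gt0.
have [M [n [M_gt0 M_dvd sparse_M]]] := sparse (Y ^ l)%N.
have MY : (M %| Y)%N by rewrite dvdn_mulr.
pose t := (Y %/ M)%N.
have YE : Y = (M * t)%N by rewrite mulnC divnK.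
have t_gt0 : (0 < t)%N by rewrite divn_gt0// dvdn_leq.
have D_large : (C * Y ^ l < q ^ D)%N.
  apply: (@leq_trans (2 ^ D)); last by elim: (D) => // d IH; rewrite !expnS leq_mul.
  rewrite /D expnD /Y expnMn mulnA -expnM [(u * l)%N]mulnC ltn_pmul2r ?expn_gt0//.
  exact: ltn_expl.
have D_small : (2 ^ l.+2 * (P * D.+1) <= Y)%N.
  rewrite mulnCA leq_pmul2l//; apply: leq_trans u_large.
  rewrite -mulnA leq_pmul2l ?expn_gt0// /D; clear; nia.
have [Y_le tail_Y] := (D_large, fun N => tail_le Y N Y_gt0).
rewrite YE in sparse_M tail_Y Y_le.
have count_le := dominated_count_le l_gt0 M_gt0 t_gt0 q_ge2 al_gt0 tail_Y Y_le sparse_M.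
rewrite -YE in count_le.
have := dominated_count_ge D l_gt0 Y_gt0 n M_gt0; apply/negP; rewrite -ltnNge.
rewrite -(ltr_nat rat) mulnDr natrD.
have Y_r : 0 < (Y ^ l)%:R :> rat by rewrite ltr0n expn_gt0 Y_gt0.
apply: le_lt_trans (_ : (Y ^ l)%:R / 4%:R + (Y ^ l)%:R / 2%:R < _); last by lra.
apply: lerD.
  rewrite natrM; apply: le_trans (ler_wpM2l (ler0n _ _) count_le) _.
  have -> : (Y ^ l)%:R = (t ^ l * M ^ l.-1)%:R * M%:R :> rat.
    by rewrite -natrM -mulnA -expnSr prednK// YE expnMn mulnC.
  rewrite /eta le_eqVlt; apply/orP; left; apply/eqP; rewrite natrM natrX !exprS.
  have pow_neq0 : 2%:R ^+ l != 0 :> rat by rewrite expf_neq0.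
  by field; rewrite pow_neq0 gt_eqF.
rewrite ler_pdivlMr// -natrM ler_nat.
apply: leq_trans (_ : 2 ^ l.+2 * (P * D.+1) * Y ^ l.-1 <= _)%N.
  rewrite [(2 ^ l.+2)%N]expnS; move: (dvdn_leq P_gt0 M_dvd) => MP.
  apply: leq_trans (_ : 2 ^ l.+1 * P * (D.+1 * Y ^ l.-1) * 2 <= _)%N.
    by rewrite !leq_mul2r leq_mul2l MP !orbT.
  by rewrite leq_eqVlt; apply/orP; left; apply/eqP; ring.
have -> : (Y ^ l = Y * Y ^ l.-1)%N by rewrite -expnS prednK.
by rewrite leq_mul2r D_small orbT.
Qed.

From mathcomp Require Import all_classical all_reals all_analysis.
Import numFieldNormedType.Exports.

(** * The series *)

Local Open Scope ring_scope.

Lemma leq_addX (l m n : nat) : (0 < l)%N -> (m ^ l + n <= (m + n) ^ l)%N.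
Proof.
case: l => // l _; elim: l => [|l IH]; first by rewrite !expn1.
rewrite expnSr [leqRHS]expnSr mulnDr; apply: leq_add.
  by rewrite leq_mul2r (leq_trans _ IH) ?orbT// leq_addr.
case: n IH => // n IH.
by rewrite leq_pmull// expn_gt0 addnS.
Qed.

Lemma geometric_half_le (F : realFieldType) (k : nat) :
  \sum_(i < k) (2%:R ^+ i)^-1 <= 2%:R :> F.
Proof.
suff : \sum_(i < k) (2%:R ^+ i)^-1 + 2%:R * (2%:R ^+ k)^-1 <= 2%:R :> F.
  by apply: le_trans; rewrite lerDl mulr_ge0 ?invr_ge0 ?exprn_ge0 ?ler0n.
elim: k => [|k IH]; first by rewrite big_ord0 add0r expr0 invr1 mulr1.
apply: le_trans IH; rewrite big_ord_recr /= -addrA lerD2l exprS invfM mulrA.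
by rewrite mulfV// mul1r mulr_natl mulr2n.
Qed.

Section Theta.
Variables (R : realType) (l q : nat).
Hypotheses (l_gt0 : (0 < l)%N) (q_ge2 : (2 <= q)%N).

Local Notation theta_ := (theta l (q%:R : R)).
Definition theta_part (Y : nat) : R := \sum_(x < Y) (q%:R ^+ (x ^ l)%N)^-1.

Let q_gt0 : 0 < q%:R :> R.
Proof. by rewrite ltr0n ltnW. Qed.

Let term_ge0 n : 0 <= (q%:R ^+ n)^-1 :> R.
Proof. by rewrite invr_ge0 exprn_ge0// ltW. Qed.

Let theta_seriesE n : series (fun n : nat => (q%:R ^+ (n ^ l)%N)^-1) n = theta_part n.
Proof. by rewrite /series /= big_mkord. Qed.

Let cvg : cvgn (series (fun n : nat => (q%:R ^+ (n ^ l)%N)^-1 : R)).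
Proof. by apply: cvg_theta => //; rewrite ltr1n. Qed.

Lemma theta_part_le Y : theta_part Y <= theta_.
Proof.
rewrite -theta_seriesE /theta; apply: nondecreasing_cvgn_le cvg _.
apply/nondecreasing_seqP => n; rewrite !theta_seriesE /theta_part big_ord_recr /=.
by rewrite lerDl.
Qed.

Lemma theta_le_part Y : theta_ <= theta_part Y + 2%:R * (q%:R ^+ (Y ^ l))^-1.
Proof.
rewrite /theta; apply: limr_le; first exact: cvg.
near=> n; rewrite theta_seriesE.
have Yn : (Y <= n)%N by near: n; exists Y.
rewrite -(subnKC Yn) /theta_part big_split_ord /= lerD2l.
apply: le_trans (_ : \sum_(i < n - Y) (q%:R ^+ (Y ^ l))^-1 * (2%:R ^+ i)^-1 <= _).
  apply: ler_sum => i _; rewrite -invfM lef_pV2 ?posrE ?mulr_gt0 ?exprn_gt0//.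
  apply: le_trans (_ : q%:R ^+ (Y ^ l + i) <= _).
    rewrite exprD ler_pM2l ?exprn_gt0//; apply: lerXn2r; rewrite ?nnegrE ?ler0n//.
    by rewrite ler_nat.
  by apply: ler_weXn2l; [rewrite ler1n ltnW | exact: leq_addX].
by rewrite -mulr_sumr mulrC ler_wpM2r// geometric_half_le.
Unshelve. all: by end_near. Qed.

Let theta_part_ge0 Y : 0 <= theta_part Y.
Proof. by apply: sumr_ge0. Qed.

Let theta_ge0 : 0 <= theta_.
Proof. exact: le_trans (theta_part_le 0). Qed.

Let theta_le2 : theta_ <= 2%:R.
Proof.
have := theta_le_part 0; rewrite /theta_part big_ord0 add0r exp0n// expr0.
by rewrite invr1 mulr1.
Qed.

Lemma sub_powers_le (x y : R) j : 0 <= y -> y <= x -> x <= 2%:R ->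
  x ^+ j - y ^+ j <= (j * 2 ^ j)%:R * (x - y).
Proof.
move=> y0 yx x2; have x0 := le_trans y0 yx.
elim: j => [|j IH]; first by rewrite !expr0 subrr mul0n mul0r.
have xy0 : 0 <= x - y by rewrite subr_ge0.
have -> : x ^+ j.+1 - y ^+ j.+1 = x * (x ^+ j - y ^+ j) + y ^+ j * (x - y).
  by rewrite !exprS; ring.
have -> : (j.+1 * 2 ^ j.+1)%:R * (x - y) =
   2%:R * ((j * 2 ^ j)%:R * (x - y)) + 2%:R ^+ j.+1 * (x - y).
  by rewrite -!natrX mulrA -mulrDl -natrM -natrD; congr (_%:R * _); rewrite expnS; ring.
apply: lerD.
  by apply: ler_pM => //; rewrite subr_ge0 lerXn2r.
rewrite ler_wpM2r//; apply: le_trans (_ : 2%:R ^+ j <= _).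
  by rewrite lerXn2r ?nnegrE ?ler0n// (le_trans yx).
by rewrite ler_weXn2l// ler1n.
Qed.

Lemma theta_partX Y j : theta_part Y ^+ j =
  \sum_(x : {ffun 'I_j -> 'I_Y}) (q%:R ^+ (\sum_i x i ^ l)%N)^-1.
Proof.
rewrite -{1}[j]card_ord -prodr_const /theta_part bigA_distr_bigA /=.
by apply: eq_bigr => x _; rewrite prodfV expr_sum.
Qed.

Let low Y j N : R := \sum_(m < N.+1) (nreps l Y j m)%:R / q%:R ^+ m.

Let lowE Y j N : low Y j N =
  \sum_(x : {ffun 'I_j -> 'I_Y} | (\sum_i x i ^ l <= N)%N)
    (q%:R ^+ (\sum_i x i ^ l)%N)^-1.
Proof.
rewrite /low.
under eq_bigr => m _ do rewrite /nreps -sum1_card natr_sum mulr_suml.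
rewrite (exchange_big_dep (fun x : {ffun 'I_j -> 'I_Y} => (\sum_i x i ^ l <= N)%N)) /=.
  apply: eq_bigr => x xN; rewrite -ltnS in xN.
  rewrite (big_pred1 (Ordinal xN)) ?mul1r// => m; rewrite !inE.
  by rewrite eq_sym -val_eqE.
by move=> m x _; rewrite inE => /eqP ->; rewrite -ltnS.
Qed.

(** After scaling by q^N, each tuple below Y whose power sum exceeds N contributes at most 1, in
    total at most Y^j; replacing theta by its partial sum costs O(q^-(Y^l)), harmless because N <
    Y^l. *)
Lemma theta_low_le Y j N : (0 < Y)%N -> (N < Y ^ l)%N -> (j <= l)%N ->
  `|q%:R ^+ N * (theta_ ^+ j - low Y j N)| <= ((1 + j * 2 ^ j) * Y ^ l)%:R.
Proof.
move=> Y_gt0 N_lt jl.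
have low_le : low Y j N <= theta_part Y ^+ j.
  rewrite lowE theta_partX [leRHS](bigID (fun x : {ffun 'I_j -> 'I_Y} => (\sum_i x i ^ l <= N)%N)) /=.
  by rewrite lerDl sumr_ge0.
have part_le : theta_part Y ^+ j <= theta_ ^+ j.
  by rewrite lerXn2r ?nnegrE ?theta_part_le.
have low_ge : q%:R ^+ N * (theta_part Y ^+ j - low Y j N) <= (Y ^ j)%:R.
  rewrite lowE theta_partX (bigID (fun x : {ffun 'I_j -> 'I_Y} => (\sum_i x i ^ l <= N)%N)) /=.
  rewrite addrAC subrr add0r mulr_sumr.
  apply: le_trans (_ : \sum_(x : {ffun 'I_j -> 'I_Y}) 1 <= _); last first.
    by rewrite sumr_const card_ffun !card_ord.
  rewrite big_mkcond /=; apply: ler_sum => x _; case: ifP => // xN.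
  rewrite ler_pdivrMr ?exprn_gt0// mul1r ler_weXn2l ?ler1n 1?ltnW//.
  by rewrite ltnNge xN.
have part_ge : q%:R ^+ N * (theta_ ^+ j - theta_part Y ^+ j) <= (j * 2 ^ j)%:R.
  apply: le_trans (_ : q%:R ^+ N * ((j * 2 ^ j)%:R *
      (2%:R * (q%:R ^+ (Y ^ l))^-1)) <= _).
    rewrite ler_wpM2l ?exprn_ge0 ?(ltW q_gt0)//.
    apply: le_trans (sub_powers_le j (theta_part_ge0 Y) (theta_part_le Y) theta_le2) _.
    by rewrite ler_wpM2l ?ler0n// lerBlDl theta_le_part.
  rewrite mulrCA -[leRHS]mulr1 ler_wpM2l ?ler0n// mulrA ler_pdivrMr ?exprn_gt0// mul1r.
  (* N + 1 <= Y^l leaves a spare factor q, which absorbs the 2 of the geometric tail. *)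
  apply: le_trans (_ : q%:R ^+ N.+1 <= _); last by rewrite ler_weXn2l// ler1n ltnW.
  by rewrite exprSr ler_pM2l ?exprn_gt0// ler_nat.
rewrite ger0_norm; last first.
  by rewrite mulr_ge0 ?exprn_ge0 ?(ltW q_gt0)// subr_ge0 (le_trans low_le).
have -> : theta_ ^+ j - low Y j N =
  (theta_part Y ^+ j - low Y j N) + (theta_ ^+ j - theta_part Y ^+ j) by ring.
rewrite mulrDr; apply: le_trans (lerD low_ge part_ge) _.
rewrite -natrD ler_nat mulnDl mul1n leq_add ?leq_pexp2l//.
by rewrite leq_pmulr// expn_gt0 Y_gt0.
Qed.

(** Adding q^N times the relation turns each initial part [low] into the error theta^j - low,
    bounded by [theta_low_le]. *)
Lemma tail_bounded (a : nat -> int) :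
  \sum_(j < l.+1) (a j)%:~R * theta_ ^+ j = 0 ->
  exists C, forall Y N, (0 < Y)%N -> (N < Y ^ l)%N ->
    `|tail l Y q a N| <= (C * Y ^ l)%N%:Z.
Proof.
move=> rel; exists (\sum_(j < l.+1) `|a j| * (1 + j * 2 ^ j))%N => Y N Y_gt0 N_lt.
have tE : (tail l Y q a N)%:~R =
    \sum_(j < l.+1) (a j)%:~R * (q%:R ^+ N * (theta_ ^+ j - low Y j N)) :> R.
  have -> : (tail l Y q a N)%:~R = - (q%:R ^+ N * \sum_(j < l.+1) (a j)%:~R * low Y j N).
    rewrite /tail rmorphN rmorph_sum /=; congr (- _).
    rewrite mulr_sumr /low.
    under [RHS]eq_bigr => j _ do rewrite !mulr_sumr.
    rewrite exchange_big /=; apply: eq_bigr => m _.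
    rewrite rmorphM /tail_coef rmorph_sum mulr_suml /=; apply: eq_bigr => j _.
    have mN : (m <= N)%N by rewrite -ltnS.
    have -> : q%:R ^+ N = q%:R ^+ m * q%:R ^+ (N - m) :> R by rewrite -exprD subnKC.
    rewrite rmorphM /= -!pmulrn natrX.
    by field; rewrite expf_neq0// gt_eqF.
  under [RHS]eq_bigr => j _ do rewrite mulrCA mulrBr.
  rewrite -mulr_sumr sumrB rel sub0r mulrN.
  by [].
rewrite -(ler_int R) intr_norm tE; apply: le_trans (ler_norm_sum _ _ _) _.
rewrite -pmulrn big_distrl natr_sum /=; apply: ler_sum => j _.
rewrite normrM -mulnA natrM -intr_norm -[`|a j|]abszE -pmulrn ler_wpM2l ?ler0n//.
by rewrite theta_low_le// -ltnS.
Qed.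

End Theta.

(** * From algebraicity to an integer relation *)

Local Open Scope ring_scope.

(** The positive coefficient has to sit at n exactly, even if p has smaller degree: a power of the
    indeterminate moves the leading coefficient there, and a change of sign makes it positive. *)
Lemma integer_relation (R : realType) (x : R) (p : {poly rat}) (n : nat) :
  p != 0 -> (size p <= n.+1)%N -> root (map_poly ratr p) x ->
  exists2 a : nat -> int, 0 < a n & \sum_(j < n.+1) (a j)%:~R * x ^+ j = 0.
Proof.
move=> p_neq0 size_p px; pose p' := p * 'X^(n.+1 - size p).
have size_p' : size p' = n.+1.
  by rewrite size_mulXn// subnK.
have [r [b b_neq0 p'E]] := rat_poly_scale p'.
have b_r : b%:~R != 0 :> rat by rewrite intr_eq0.
have size_r : size r = n.+1.
  rewrite -size_p' p'E size_scale ?invr_eq0// size_map_poly_id0//.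
  rewrite intr_eq0 lead_coef_eq0; apply: contra_eq_neq size_p' => r0.
  by rewrite p'E r0 rmorph0 scaler0 size_poly0.
have rx : \sum_(j < n.+1) (r`_j)%:~R * x ^+ j = 0.
  have : root (map_poly ratr p') x by rewrite rmorphM rootM px.
  rewrite p'E map_polyZ /= rootZ ?fmorph_eq0 ?invr_eq0//.
  rewrite -map_poly_comp /= => /rootP rx0.
  rewrite -[RHS]rx0 (@horner_coef_wide _ n.+1); last first.
    by rewrite -size_r size_poly.
  apply: eq_bigr => j _; rewrite coef_map_id0 /= ?ratr_int//.
have rn_neq0 : r`_n != 0.
  have := lead_coef_eq0 r; rewrite /lead_coef size_r /= => ->.
  by rewrite -size_poly_eq0 size_r.
case: (ltrgt0P r`_n) rn_neq0 => // rn _; first by exists (fun j => r`_j).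
exists (fun j => - r`_j); first by rewrite oppr_gt0.
under eq_bigr => j _ do rewrite rmorphN mulNr.
by rewrite sumrN rx oppr0.
Qed.

Theorem theorem1p1 (R : realType) (l : nat) (hl : l = 3%N \/ l = 4%N)
    (q : int) (hq : 2 <= q) :
  algebraicOver ratr (theta l (q%:~R : R)) ->
  (l + 1 <= deg_rat (theta l (q%:~R : R)))%N.
Proof.
move=> /minpoly_ratP[p_monic p_root _].
rewrite leqNgt; apply/negP => deg_lt.
have l_gt0 : (0 < l)%N by case: hl => ->.
have size_p : (size (minpoly_rat (theta l (q%:~R : R))) <= l.+1)%N.
  by move: deg_lt; rewrite /deg_rat addn1; case: (size _).
have [a al_gt0 rel] := integer_relation (monic_neq0 p_monic) size_p p_root.
have [q' q'E] : exists q' : nat, q = q'%:Z by exists `|q|%N; lia.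
rewrite {}q'E -pmulrn in hq rel.
have [C tail_le] := tail_bounded l_gt0 hq rel.
exact: tail_unbounded hl hq al_gt0 tail_le.
Qed.
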